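(* Let $\mathrm{R}$ be a spherical root system, $\mu$ an ultrafilter on an infinite set $I$, and $(X_i,\mathcal{A}_i)_{i\in I}$ a sequence of generalized affine buildings, where $(X_i,\mathcal{A}_i)$ is modeled on $\mathbb{A}(\mathrm{R},\Lambda_i)$ with $\Lambda_i$ a totally ordered abelian group, and where $d_i$ is the $\Lambda_i$-valued metric on $X_i$. Then the ultraproduct $({}^*X,{}^*\mathcal{A})$ is a generalized affine building modeled on $\mathbb{A}(\mathrm{R},{}^*\Lambda)$ and carries a natural ${}^*\Lambda$-valued metric ${}^*d$ induced by the metrics $d_i$.
   Context: Root system and model space. $\mathrm{R}$ is a (not necessarily crystallographic) spherical root system with basis $B$ and positive roots $\mathrm{R}^+$; $\langle\beta,\alpha^\vee\rangle$ is the evaluation of the co-root of $\alpha$ on $\beta$; $F\subseteq\mathbb{R}$ is a subfield containing all $\langle\beta,\alpha^\vee\rangle$. Value groups are non-trivial totally ordered abelian groups that are ordered $F$-modules. The model space is $\mathbb{A}=\mathbb{A}(\mathrm{R},\Lambda)=\mathrm{span}_F(\mathrm{R})\otimes_F\Lambda\cong\{\sum_{\alpha\in B}\lambda_\alpha\alpha:\lambda_\alpha\in\Lambda\}$; $\langle\cdot,\alpha^\vee\rangle$ extends linearly to $\mathbb{A}\to\Lambda$. The spherical Weyl group $\overline W$ acts on $\mathbb{A}$ via the reflections $r_\alpha$, and $W=\overline W\rtimes T$ is the full affine Weyl group, $T=\mathbb{A}$ acting by translations. Hyperplanes are fixed point sets of $W$-conjugates of the $r_\alpha$; each bounds two (closed)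 half-apartments. The fundamental Weyl chamber is $\{x:\langle x,\alpha^\vee\rangle\ge 0\ \forall\alpha\in\mathrm{R}^+\}$; Weyl chambers are its $W$-images. The metric on $\mathbb{A}$ is $d(x,y)=\sum_{\alpha\in\mathrm{R}^+}|\langle y-x,\alpha^\vee\rangle|$. A subset of $\mathbb{A}$ is convex if it is a finite intersection of half-apartments ($\emptyset$ and $\mathbb{A}$ included). Generalized affine building. A $\Lambda$-building modeled on $\mathbb{A}$ is a set $X$ with a collection $\mathcal{A}$ of injective maps $f:\mathbb{A}\to X$ (charts), whose images are called apartments; Weyl chambers, half-apartments, etc. of $X$ are images of such under charts; subject to: (A1) $f\in\mathcal{A}$, $w\in W$ imply $f\circ w\in\mathcal{A}$. (A2) For $f,g\in\mathcal{A}$ the set $f^{-1}(g(\mathbb{A}))$ is convex and there is $w\in W$ with $f=g\circ w$ on it. (A3) Any two points lie in a common apartment. (A4) For any two Weyl chambers $S_1,S_2$ there are sub-Weyl chambers $S_i'\subset S_i$ contained in a common apartment. (A5) For each apartment $A$ and $x\in A$ there is a retraction $r_{A,x}:X\to A$ not increasing distances with $r_{A,x}^{-1}(x)=\{x\}$. (A6) If three apartments pairwise intersect in half-apartments, then all three have a common point. The distance on $X$ is transported from $\mathbb{A}$ by charts. Ultraproducts. An ultrafilter on $I$ is a finitely additive measure $\mu:2^I\to\{0,1\}$ with $\mu(I)=1$. The ultraproduct ${}^*X$ of sets $(X_i)$ is $\prod X_i$ modulo $x\sim y\Leftrightarrow\mu(\{i:x_i=y_i\})=1$. The ultraproduct ${}^*\Lambda$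 of the ordered abelian groups $\Lambda_i$ is an ordered abelian group ($[a]\le[b]$ iff $\mu\{i:a_i\le b_i\}=1$), and ${}^*d([x],[y])=[(d_i(x_i,y_i))_i]\in{}^*\Lambda$. ${}^*\mathcal{A}$ is the set of classes of sequences of charts $f_i\in\mathcal{A}_i$, acting componentwise on the ultraproduct of the model spaces $\mathbb{A}(\mathrm{R},\Lambda_i)$, which is identified with $\mathbb{A}(\mathrm{R},{}^*\Lambda)$ via coordinates. *)

(* Defs.v *)
From HB Require Import structures.
From mathcomp Require Import all_boot all_order all_algebra.
From mathcomp Require Import finmap generic_quotient.
From mathcomp Require Import mathcomp_extra boolp classical_sets cardinality reals.

Set Implicit Arguments.
Unset Strict Implicit.
Unset Printing Implicit Defensive.

Import Order.TTheory GRing.Theory Num.Theory.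

Local Open Scope fset_scope.
Local Open Scope classical_set_scope.
Local Open Scope ring_scope.
Local Open Scope quotient_scope.

(* [F] is a subfield of the real field [R], with inclusion [\val]. The order   *)
(* is total, see [ordmod_total]; value groups are nontrivial.                *)
HB.mixin Record isOrderedModule (R : realType) (P : pred R) (F : subFieldType P) M
    of Num.POrderedZmodule M & GRing.Lmodule F M := {
  ordmod_total : total (<=%R : rel M);
  ordmod_leD : forall x y z : M, x <= y -> x + z <= y + z;
  ordmod_scale_ge0 : forall (c : F) (x : M),
    0 <= (\val c : R) -> 0 <= x -> 0 <= c *: x;
  ordmod_nontrivial : exists x : M, x != 0
}.

#[short(type="orderedModType")]
HB.structure Definition OrderedModule (R : realType) (P : pred R) (F : subFieldType P) :=
  {M of Num.POrderedZmodule M & GRing.Lmodule F M & isOrderedModule R P F M}.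

Definition absm (R : realType) (P : pred R) (F : subFieldType P)
    (L : orderedModType F) (x : L) : L :=
  Num.max x (- x).

Definition is_metric (R : realType) (P : pred R) (F : subFieldType P)
    (L : orderedModType F) (X : Type) (d : X -> X -> L) : Prop :=
  [/\ forall x y, 0 <= d x y,
      forall x y, d x y = 0 <-> x = y,
      forall x y, d x y = d y x
    & forall x y z, d x z <= d x y + d y z].

Definition dot (R : realType) (n : nat) (u v : 'rV[R]_n) : R := (u *m v^T) 0 0.

(* <b, a^v>, the evaluation of the co-root of [a] on [b] *)
Definition coroot_eval (R : realType) (n : nat) (b a : 'rV[R]_n) : R :=
  2 * dot b a / dot a a.

(* No crystallographic condition is imposed; neither are the frequent          *)
(* conventions that roots span the whole space or that the only multiples of  *)
(* a root [a] among the roots are [a] and [- a].                              *)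
Record root_system (R : realType) (n : nat) := RootSystem {
  roots : {fset 'rV[R]_n};
  base : {fset 'rV[R]_n};
  root_neq0 : 0 \notin roots;
  root_refl : forall a b, a \in roots -> b \in roots ->
    b - coroot_eval b a *: a \in roots;
  base_roots : {subset base <= roots};
  base_free : free (enum_fset base);
  base_sign : forall a, a \in roots -> exists c : base -> R,
    a = \sum_(b : base) c b *: \val b /\
    ((forall b, 0 <= c b) \/ (forall b, c b <= 0))
}.

Definition positive_root (R : realType) (n : nat) (Phi : root_system R n)
    (a : 'rV[R]_n) : Prop :=
  a \in roots Phi /\ exists c : base Phi -> R,
    a = \sum_(b : base Phi) c b *: \val b /\ (forall b, 0 <= c b).

Definition contains_coroot_evals (R : realType) (n : nat) (Phi : root_system R n)
    (P : pred R) : Prop :=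
  forall a b, a \in roots Phi -> b \in roots Phi -> coroot_eval b a \in P.

(* The coordinates of a root in the base. They exist in [F] when [F] contains *)
(* the evaluations of the co-roots, see [root_coordE] below.                  *)
Definition root_coord (R : realType) (P : pred R) (F : subFieldType P) (n : nat)
    (Phi : root_system R n) (a : 'rV[R]_n) : {ffun base Phi -> F} :=
  xget 0 [set c : {ffun base Phi -> F} |
           a = \sum_(b : base Phi) (\val (c b) : R) *: \val b].

Section RootCoordinates.
Variables (R : realType) (P : pred R) (F : subFieldType P) (n : nat).
Variable Phi : root_system R n.
Implicit Types (u v a : 'rV[R]_n) (b : base Phi).

Lemma dotDl u v a : dot (u + v) a = dot u a + dot v a.
Proof. by rewrite /dot mulmxDl mxE. Qed.

Lemma dotZl (c : R) u v : dot (c *: u) v = c * dot u v.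
Proof. by rewrite /dot -scalemxAl mxE. Qed.

Lemma dotC u v : dot u v = dot v u.
Proof. by rewrite /dot !mxE; apply: eq_bigr => i _; rewrite !mxE mulrC. Qed.

Lemma dot_gt0 u : u != 0 -> 0 < dot u u.
Proof.
move=> u0; have u2 i : 0 <= u 0 i * u^T i 0 by rewrite mxE -expr2 sqr_ge0.
rewrite lt_def /dot mxE sumr_ge0 ?andbT //; apply: contraNneq u0.
move=> /eqP; rewrite psumr_eq0 // => /allP u2_0.
apply/eqP/rowP => i; rewrite [RHS]mxE.
by have := u2_0 i (mem_index_enum i); rewrite mxE -expr2 sqrf_eq0 => /eqP.
Qed.

Lemma dot_suml (T : finType) (c : T -> R) (w : T -> 'rV[R]_n) v :
  dot (\sum_i c i *: w i) v = \sum_i c i * dot (w i) v.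
Proof.
elim/big_rec2: _ => [|i x y _ <-]; first by rewrite /dot mul0mx mxE.
by rewrite dotDl dotZl.
Qed.

Definition base_index b : 'I_(size (enum_fset (base Phi))) :=
  Ordinal (etrans (index_mem (\val b) _) (valP b)).
Definition base_coord b v : R := coord (in_tuple (enum_fset (base Phi))) (base_index b) v.

Lemma base_coordE (c : base Phi -> R) b : base_coord b (\sum_b' c b' *: \val b') = c b.
Proof.
rewrite /base_coord linear_sum (bigD1 b) //= big1 ?addr0 => [|b' b'b].
  rewrite linearZ /= -[X in coord _ _ X](nth_index 0 (valP b)).
  by rewrite (coord_free (base_index b) (base_index b)) ?base_free // eqxx mulr1.
rewrite linearZ /= -[X in coord _ _ X](nth_index 0 (valP b')).
rewrite (coord_free (base_index b') (base_index b)) ?base_free //.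
rewrite -val_eqE /= (negbTE (_ : index _ _ != _)) ?mulr0 //.
apply: contra b'b => /eqP ib; apply/eqP/val_inj.
by rewrite -(nth_index 0 (valP b)) -(nth_index 0 (valP b')) /= ib.
Qed.

Definition F_span v := exists c : {ffun base Phi -> F},
  v = \sum_b (\val (c b) : R) *: \val b.

Lemma F_span_add v b (c : R) : c \in P -> F_span v -> F_span (v + c *: \val b).
Proof.
move=> cP [k ->]; pose q : F := Sub c cP.
have qE : (\val q : R) = c by apply: SubK.
exists [ffun b' => k b' + if b' == b then q else 0].
rewrite [in RHS](bigD1 b) //= [in LHS](bigD1 b) //= ffunE eqxx rmorphD /= qE.
rewrite scalerDl addrAC; congr (_ + _); apply: eq_bigr => b' /negbTE b'b.
by rewrite ffunE b'b addr0.
Qed.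

Lemma F_span_positive a : contains_coroot_evals Phi P ->
  positive_root Phi a -> F_span a.
Proof.
move=> hP.
pose ht v := \sum_b base_coord b v.
pose lower v := [fset r in roots Phi | `[< positive_root Phi r >] && (ht r < ht v)]%fset.
have [N] := ubnP #|` lower a|; elim: N a => // N IHN a; rewrite ltnS => leN pos_a.
have [aR [c [aE c0]]] := pos_a.
have a_neq0 : a != 0 by apply: contraNneq (root_neq0 Phi) => <-.
have [b cb ba] : exists2 b, 0 < c b & 0 < dot (\val b) a.
  apply: contrapT => /forall2NP no; have := dot_gt0 a_neq0.
  rewrite {1}aE dot_suml ltNge => /negP; apply; apply: sumr_le0 => b _.
  have [/negP|/negP] := no b; rewrite -leNgt => le0.
    by rewrite (_ : c b = 0) ?mul0r //; apply/le_anti; rewrite le0 c0.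
  by rewrite mulr_ge0_le0.
have bR : \val b \in roots Phi by apply: base_roots (valP b).
have b_neq0 : \val b != 0 by apply: contraNneq (root_neq0 Phi) => <-.
pose k := coroot_eval a (\val b).
have kP : k \in P by apply: hP.
have k_gt0 : 0 < k by rewrite /k /coroot_eval divr_gt0 ?dot_gt0 // mulr_gt0 // dotC.
have a'R := root_refl bR aR; rewrite -/k in a'R.
have [c' [a'E sgn]] := base_sign a'R.
have base_coord_a' b' : c' b' = c b' - (if b' == b then k else 0).
  rewrite -(base_coordE c' b') -a'E /base_coord linearB linearZ /= -/(base_coord b' a) {1}aE base_coordE.
  have -> : \val b = \sum_b0 (b0 == b)%:R *: \val b0.
    rewrite (bigD1 b) //= eqxx scale1r big1 ?addr0 // => b0 /negbTE->.
    by rewrite scale0r.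
  by rewrite -/(base_coord b' _) (base_coordE (fun b0 => (b0 == b)%:R)); case: eqP; rewrite ?mulr1 ?mulr0.
have [c'0|c'0] := sgn; last first.
  have c_eq0 b' : b' != b -> c b' = 0.
    move=> /negbTE b'b; have := base_coord_a' b'; rewrite b'b subr0 => c'c.
    by apply/le_anti; rewrite c0 -c'c c'0.
  have aE' : a = c b *: \val b.
    by rewrite aE (bigD1 b) //= big1 ?addr0 // => b' /c_eq0->; rewrite scale0r.
  have k2 : k = 2 * c b.
    rewrite /k /coroot_eval [in LHS]aE' dotZl mulrA mulfK //.
    by rewrite gt_eqF ?dot_gt0.
  pose k' : F := Sub k kP; pose q : F := k' / 2.
  have k'E : (\val k' : R) = k by apply: SubK.
  exists [ffun b' => if b' == b then q else 0].
  rewrite [LHS]aE'; apply/esym; rewrite (bigD1 b) //= ffunE eqxx big1 ?addr0 => [|b' /negbTE b'b].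
    by rewrite /q fmorph_div rmorph_nat /= k'E k2 mulrAC mulfV ?mul1r // pnatr_eq0.
  by rewrite ffunE b'b rmorph0 scale0r.
have pos_a' : positive_root Phi (a - k *: \val b) by split=> //; exists c'.
rewrite -[a](subrK (k *: \val b)); apply: F_span_add kP _; apply: IHN => //.
have ht_a' : ht (a - k *: \val b) < ht a.
  rewrite /ht a'E {1}aE; under eq_bigr do rewrite base_coordE base_coord_a'.
  under [ltRHS]eq_bigr do rewrite base_coordE.
  rewrite sumrB ltrBlDr ltrDl -big_mkcond /= big_pred1_eq.
  exact: k_gt0.
apply: leq_trans leN; apply/fproper_ltn_card; rewrite fproperE; apply/andP; split.
  apply/fsubsetP => r; rewrite !inE /= => /and3P[-> -> /= rlt].
  exact: lt_trans rlt ht_a'.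
apply/fsubsetPn; exists (a - k *: \val b); rewrite !inE /= a'R ?ht_a' ?ltxx ?andbF //.
by rewrite andbT; apply/asboolP.
Qed.

Lemma root_coordE a : contains_coroot_evals Phi P -> a \in roots Phi ->
  a = \sum_(b : base Phi) (\val (root_coord F Phi a b) : R) *: \val b.
Proof.
move=> hP aR; suff [c cE] : F_span a.
  by rewrite /root_coord; case: xgetP => [? _ //|/(_ c)]; case.
have [c [aE [c0|c0]]] := base_sign aR.
  by apply: F_span_positive => //; split=> //; exists c.
have a_neq0 : a != 0 by apply: contraNneq (root_neq0 Phi) => <-.
have NaR : - a \in roots Phi.
  have := root_refl aR aR; rewrite /coroot_eval mulfK ?gt_eqF ?dot_gt0 //.
  by rewrite scaler_nat mulr2n opprD addrA subrr add0r.
have [|k kE] := F_span_positive (a := - a) hP.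
  split=> //; exists (fun b => - c b); split=> [|b]; last by rewrite oppr_ge0.
  by rewrite aE -sumrN; apply: eq_bigr => b _; rewrite scaleNr.
exists [ffun b => - k b]; rewrite -[LHS]opprK kE -sumrN.
by apply: eq_bigr => b _; rewrite ffunE rmorphN scaleNr.
Qed.

End RootCoordinates.

(* [x] stands for the sum of the [x b * b] over the base *)
Definition model (R : realType) (P : pred R) (F : subFieldType P) (n : nat)
    (Phi : root_system R n) (L : orderedModType F) :=
  {ffun base Phi -> L}.

Section ModelSpace.
Variables (R : realType) (P : pred R) (F : subFieldType P) (n : nat).
Variables (Phi : root_system R n) (L : orderedModType F).
Local Notation A := (model Phi L).

(* the [L]-linear extension of <_, a^v>; [insubd 0] sends a real number in [P] *)
(* to the corresponding element of [F]                                         *)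
Definition pairing (x : A) (a : 'rV[R]_n) : L :=
  \sum_(b : base Phi) insubd (0 : F) (coroot_eval (\val b) a) *: x b.

Definition refl (a : 'rV[R]_n) (x : A) : A :=
  x - [ffun b => root_coord F Phi a b *: pairing x a].

(* the group generated by the reflections, which are involutions *)
Inductive spherical_weyl : (A -> A) -> Prop :=
| spherical_weyl_id : spherical_weyl id
| spherical_weyl_refl a w : a \in roots Phi -> spherical_weyl w ->
    spherical_weyl (refl a \o w).

Definition affine_weyl : set (A -> A) :=
  [set w | exists (w0 : A -> A) (t : A),
    spherical_weyl w0 /\ w = (fun x => w0 x + t)].

(* The fixed point set of [w \o refl a \o w^-1] is the image by [w] of the    *)
(* hyperplane [pairing x a = 0]; its two sides come from [a] and [- a].       *)
Definition half_apartment (H : set A) : Prop :=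
  exists (w : A -> A) (a : 'rV[R]_n),
    [/\ affine_weyl w, a \in roots Phi & H = w @` [set x | 0 <= pairing x a]].

Definition fundamental_chamber : set A :=
  [set x | forall a, positive_root Phi a -> 0 <= pairing x a].

Definition weyl_chamber (S : set A) : Prop :=
  exists2 w, affine_weyl w & S = w @` fundamental_chamber.

Definition model_dist (x y : A) : L :=
  \sum_(a <- enum_fset (roots Phi) | `[< positive_root Phi a >])
     absm (pairing (y - x) a).

Definition convex (C : set A) : Prop :=
  C = set0 \/ exists Hs : set (set A),
    [/\ finite_set Hs, Hs `<=` half_apartment & C = \bigcap_(H in Hs) H].

End ModelSpace.

Section Building.
Variables (R : realType) (P : pred R) (F : subFieldType P) (n : nat).
Variables (Phi : root_system R n) (L : orderedModType F).
Local Notation A := (model Phi L).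
Variables (X : Type) (charts : set (A -> X)).

Definition apartment (Y : set X) : Prop := exists2 f, charts f & Y = range f.

Definition bld_half_apartment (Y : set X) : Prop :=
  exists f H, [/\ charts f, half_apartment H & Y = f @` H].

Definition bld_weyl_chamber (Y : set X) : Prop :=
  exists f S, [/\ charts f, weyl_chamber S & Y = f @` S].

(* the distance transported by charts, with junk value 0 for two points that  *)
(* lie in no common apartment                                                 *)
Definition bld_dist (x y : X) : L :=
  xget 0 [set l | exists f a b,
    [/\ charts f, f a = x, f b = y & l = model_dist a b]].

Record building : Prop := Building {
  chart_inj : forall f, charts f -> injective f;
  building_A1 : forall f w, charts f -> affine_weyl w -> charts (f \o w);
  building_A2 : forall f g, charts f -> charts g ->
    convex (f @^-1` range g) /\
    exists2 w, affine_weyl w & forall x, range g (f x) -> f x = g (w x);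
  building_A3 : forall x y, exists Y, [/\ apartment Y, Y x & Y y];
  building_A4 : forall S1 S2, bld_weyl_chamber S1 -> bld_weyl_chamber S2 ->
    exists T1 T2 Y,
      [/\ bld_weyl_chamber T1 /\ T1 `<=` S1, bld_weyl_chamber T2 /\ T2 `<=` S2,
          apartment Y & T1 `|` T2 `<=` Y];
  building_A5 : forall Y x, apartment Y -> Y x -> exists r : X -> X,
    [/\ forall y, Y (r y),
        forall y, Y y -> r y = y,
        forall y z, bld_dist (r y) (r z) <= bld_dist y z
      & r @^-1` [set x] = [set x]];
  building_A6 : forall Y1 Y2 Y3, apartment Y1 -> apartment Y2 -> apartment Y3 ->
    bld_half_apartment (Y1 `&` Y2) -> bld_half_apartment (Y1 `&` Y3) ->
    bld_half_apartment (Y2 `&` Y3) ->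
    Y1 `&` Y2 `&` Y3 !=set0
}.

End Building.

(* a finitely additive {0,1}-valued measure; principal ones are allowed *)
Record ultrafilter (I : Type) := Ultrafilter {
  umeas :> set I -> bool;
  umeasT : umeas setT;
  umeasU : forall A B : set I, A `&` B = set0 ->
    umeas (A `|` B) = (umeas A + umeas B)%N :> nat
}.

Section UltrafilterTheory.
Variables (I : Type) (mu : ultrafilter I).

Lemma umeas0 : mu set0 = false.
Proof. by have := umeasU mu (set0I set0); rewrite setU0; case: (mu set0). Qed.

Lemma umeasC (A : set I) : mu (~` A) = ~~ mu A.
Proof.
have := umeasU mu (setICr A); rewrite setUCr umeasT.
by case: (mu A); case: (mu (~` A)).
Qed.

Lemma umeasS (A B : set I) : A `<=` B -> mu A -> mu B.
Proof.
move=> AB muA; rewrite -(setDUK AB).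
by have := umeasU mu (setDIK A B); rewrite muA; case: (mu (A `|` _)).
Qed.

Lemma umeasI (A B : set I) : mu A -> mu B -> mu (A `&` B).
Proof.
move=> muA muB; apply: contraT; rewrite -umeasC setCI => muC.
have /umeasS/(_ muC) : ~` A `|` ~` B `<=` ~` A `|` (~` B `&` A).
  by move=> i; have [?|?] := pselect (A i); rewrite /setU /setI /setC /=; tauto.
have disj : ~` A `&` (~` B `&` A) = set0.
  by apply/seteqP; split=> i //= [? []].
have := umeasU mu disj; rewrite umeasC muA /=.
have -> : mu (~` B `&` A) = false.
  apply/negbTE/negP => muBA; have /umeasS/(_ muBA) : ~` B `&` A `<=` ~` B by move=> i [].
  by rewrite umeasC muB.
by case: (mu _).
Qed.

Lemma uaeW (Q : I -> Prop) : (forall i, Q i) -> mu [set i | Q i].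
Proof. by move=> Qi; apply: umeasS (umeasT mu) => i _; apply: Qi. Qed.

Lemma uae1 (Q S : I -> Prop) : (forall i, Q i -> S i) ->
  mu [set i | Q i] -> mu [set i | S i].
Proof. by move=> QS; apply: umeasS => i; apply: QS. Qed.

Lemma uae2 (Q1 Q2 S : I -> Prop) : (forall i, Q1 i -> Q2 i -> S i) ->
  mu [set i | Q1 i] -> mu [set i | Q2 i] -> mu [set i | S i].
Proof.
move=> QS mu1 mu2; have := umeasI mu1 mu2.
by apply: umeasS => i [/=]; apply: QS.
Qed.

Lemma uae3 (Q1 Q2 Q3 S : I -> Prop) : (forall i, Q1 i -> Q2 i -> Q3 i -> S i) ->
  mu [set i | Q1 i] -> mu [set i | Q2 i] -> mu [set i | Q3 i] ->
  mu [set i | S i].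
Proof.
move=> QS mu1 mu2; apply: (uae2 (Q1 := fun i => Q1 i /\ Q2 i)).
  by move=> i [? ?]; apply: QS.
exact: uae2 mu1 mu2.
Qed.

Lemma uae_fin (T : finType) (Q : T -> I -> Prop) :
  (forall b, mu [set i | Q b i]) -> mu [set i | forall b, Q b i].
Proof.
move=> muQ; have : mu [set i | forall b, b \in enum T -> Q b i].
  elim: (enum T) => [|c s IHs]; first by apply: uaeW.
  apply: uae2 (muQ c) IHs => i Qc Qs b; rewrite inE => /orP[/eqP-> //|].
  exact: Qs.
by apply: uae1 => i Qi b; apply: Qi; rewrite mem_enum.
Qed.

End UltrafilterTheory.

Section Ultraproduct.
Variables (I : Type) (mu : ultrafilter I) (X : I -> Type).

Definition ultra_eq : rel {classic forall i, X i} :=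
  fun x y => mu [set i | x i = y i].

Lemma ultra_eq_refl : reflexive ultra_eq.
Proof. by move=> x; apply: uaeW. Qed.

Lemma ultra_eq_sym : symmetric ultra_eq.
Proof. by move=> x y; apply/idP/idP; apply: uae1. Qed.

Lemma ultra_eq_trans : transitive ultra_eq.
Proof. by move=> y x z; apply: uae2 => i ->. Qed.

Canonical ultra_equiv := EquivRel ultra_eq ultra_eq_refl ultra_eq_sym ultra_eq_trans.

Definition ultraproduct := {eq_quot ultra_equiv}.
HB.instance Definition _ := Choice.on ultraproduct.

Definition ucl (x : forall i, X i) : ultraproduct :=
  \pi_({eq_quot ultra_equiv}) (x : {classic forall i, X i}).

Definition urepr (x : ultraproduct) : forall i, X i :=
  repr (x : {eq_quot ultra_equiv}).

Lemma ureprK : cancel urepr ucl.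
Proof. by move=> x; apply: reprK. Qed.

Lemma uclP (x y : forall i, X i) : ucl x = ucl y <-> mu [set i | x i = y i].
Proof. by split=> [/eqmodP //|xy]; apply/eqmodP. Qed.

Lemma urepr_ucl (x : forall i, X i) : mu [set i | urepr (ucl x) i = x i].
Proof. by apply/uclP; rewrite ureprK. Qed.

End Ultraproduct.

Section UltraModule.
Variables (R : realType) (P : pred R) (F : subFieldType P).
Variables (I : Type) (mu : ultrafilter I) (L : I -> orderedModType F).

Definition ultra_module := ultraproduct mu L.
HB.instance Definition _ := Choice.on ultra_module.

Local Notation M := ultra_module.
Implicit Types x y z : M.

Definition ultra_zero : M := ucl mu (fun i => 0 : L i).
Definition ultra_opp x : M := ucl mu (fun i => - urepr x i).
Definition ultra_add x y : M := ucl mu (fun i => urepr x i + urepr y i).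
Definition ultra_scale (c : F) x : M := ucl mu (fun i => c *: urepr x i).
Definition ultra_le x y : bool := mu [set i | urepr x i <= urepr y i].

Lemma ucl_opp (x : forall i, L i) : ultra_opp (ucl mu x) = ucl mu (fun i => - x i).
Proof. by apply/uclP; apply: uae1 (urepr_ucl mu x) => i ->. Qed.

Lemma ucl_add (x y : forall i, L i) :
  ultra_add (ucl mu x) (ucl mu y) = ucl mu (fun i => x i + y i).
Proof.
by apply/uclP; apply: uae2 (urepr_ucl mu x) (urepr_ucl mu y) => i -> ->.
Qed.

Lemma ucl_scale c (x : forall i, L i) :
  ultra_scale c (ucl mu x) = ucl mu (fun i => c *: x i).
Proof. by apply/uclP; apply: uae1 (urepr_ucl mu x) => i ->. Qed.

Lemma ucl_le (x y : forall i, L i) :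
  ultra_le (ucl mu x) (ucl mu y) = mu [set i | x i <= y i].
Proof.
have rx := urepr_ucl mu x; have ry := urepr_ucl mu y.
by apply/idP/idP; apply: uae3 rx ry => i -> ->.
Qed.

Lemma ultra_addA : associative ultra_add.
Proof.
move=> x y z; rewrite -[x]ureprK -[y]ureprK -[z]ureprK !ucl_add.
by apply/uclP; apply: uaeW => i; rewrite addrA.
Qed.

Lemma ultra_addC : commutative ultra_add.
Proof. by move=> x y; apply/uclP; apply: uaeW => i; rewrite addrC. Qed.

Lemma ultra_add0 : left_id ultra_zero ultra_add.
Proof.
move=> x; rewrite -[x]ureprK ucl_add.
by apply/uclP; apply: uaeW => i; rewrite add0r.
Qed.

Lemma ultra_addN : left_inverse ultra_zero ultra_opp ultra_add.
Proof.
move=> x; rewrite -[x]ureprK ucl_opp ucl_add.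
by apply/uclP; apply: uaeW => i; rewrite addNr.
Qed.

HB.instance Definition _ := GRing.isZmodule.Build M
  ultra_addA ultra_addC ultra_add0 ultra_addN.

Lemma ultra_scaleA (a b : F) x :
  ultra_scale a (ultra_scale b x) = ultra_scale (a * b) x.
Proof.
rewrite -[x]ureprK !ucl_scale.
by apply/uclP; apply: uaeW => i; rewrite scalerA.
Qed.

Lemma ultra_scale1 : left_id 1 ultra_scale.
Proof.
move=> x; rewrite -[x]ureprK ucl_scale.
by apply/uclP; apply: uaeW => i; rewrite scale1r.
Qed.

Lemma ultra_scaleDr : right_distributive ultra_scale +%R.
Proof.
move=> c x y; rewrite -[x]ureprK -[y]ureprK /GRing.add /= ucl_add !ucl_scale ucl_add.
by apply/uclP; apply: uaeW => i; rewrite scalerDr.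
Qed.

Lemma ultra_scaleDl x : {morph ultra_scale^~ x : a b / a + b}.
Proof.
move=> a b; rewrite -[x]ureprK !ucl_scale [RHS]ucl_add.
by apply/uclP; apply: uaeW => i; rewrite scalerDl.
Qed.

HB.instance Definition _ := GRing.Zmodule_isLmodule.Build F M
  ultra_scaleA ultra_scale1 ultra_scaleDr ultra_scaleDl.

Lemma ultra_le_refl : reflexive ultra_le.
Proof. by move=> x; apply: uaeW. Qed.

Lemma ultra_le_anti : antisymmetric ultra_le.
Proof.
move=> x y /andP[]; rewrite -[x]ureprK -[y]ureprK !ucl_le => xy yx.
by apply/uclP; apply: uae2 xy yx => i xy yx; apply/le_anti/andP.
Qed.

Lemma ultra_le_trans : transitive ultra_le.
Proof. by move=> y x z; apply: uae2 => i; apply: le_trans. Qed.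

HB.instance Definition _ := Order.Le_isPOrder.Build ring_display M
  ultra_le_refl ultra_le_anti ultra_le_trans.

Lemma ultra_le_total : total (<=%R : rel M).
Proof.
move=> x y; apply: contraT; rewrite negb_or => /andP[nxy nyx].
suff : mu set0 by rewrite umeas0.
have := nxy; have := nyx; rewrite -!umeasC; apply: uae2 => i /=.
by have /orP[|] := ordmod_total (urepr x i) (urepr y i).
Qed.

Lemma ultra_leD x y z : x <= y -> x + z <= y + z.
Proof.
change (ultra_le x y -> ultra_le (ultra_add x z) (ultra_add y z)).
rewrite -[x]ureprK -[y]ureprK -[z]ureprK !ucl_add !ucl_le.
by apply: uae1 => i; apply: ordmod_leD.
Qed.

Lemma ultra_scale_ge0 (c : F) x : 0 <= (\val c : R) -> 0 <= x -> 0 <= c *: x.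
Proof.
move=> c0; change (ultra_le ultra_zero x -> ultra_le ultra_zero (ultra_scale c x)).
rewrite -[x]ureprK ucl_scale !ucl_le.
by apply: uae1 => i; apply: ordmod_scale_ge0.
Qed.

Lemma ultra_nontrivial : exists x, x != 0.
Proof.
pose w i := xchoose (ordmod_nontrivial (s := L i)).
exists (ucl mu w); apply/eqP => /uclP w0.
suff : mu set0 by rewrite umeas0.
by apply: uae1 w0 => i /eqP; rewrite (negbTE (xchooseP (ordmod_nontrivial (s := L i)))).
Qed.

HB.instance Definition _ := isOrderedModule.Build R P F M
  ultra_le_total ultra_leD ultra_scale_ge0 ultra_nontrivial.

End UltraModule.

Section UltraBuilding.
Variables (R : realType) (P : pred R) (F : subFieldType P) (n : nat).
Variables (Phi : root_system R n).
Variables (I : Type) (mu : ultrafilter I) (L : I -> orderedModType F).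
Variables (X : I -> Type).

(* the identification, via coordinates, of the ultraproduct of the model      *)
(* spaces with the model space of the ultraproduct                            *)
Definition model_ucl (x : forall i, model Phi (L i)) : model Phi (ultra_module mu L) :=
  [ffun b => ucl mu (fun i => x i b)].

Definition model_urepr (x : model Phi (ultra_module mu L)) i : model Phi (L i) :=
  [ffun b => urepr (x b) i].

Lemma model_ureprK : cancel model_urepr model_ucl.
Proof.
move=> x; apply/ffunP => b; rewrite ffunE -[RHS]ureprK; apply/uclP.
by apply: uaeW => i; rewrite ffunE.
Qed.

Definition ultra_chart (f : forall i, model Phi (L i) -> X i)
    (x : model Phi (ultra_module mu L)) : ultraproduct mu X :=
  ucl mu (fun i => f i (model_urepr x i)).

Lemma ultra_chartE (f : forall i, model Phi (L i) -> X i)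
    (x : forall i, model Phi (L i)) :
  ultra_chart f (model_ucl x) = ucl mu (fun i => f i (x i)).
Proof.
apply/uclP; have := uae_fin (fun b => urepr_ucl mu (fun i => x i b)).
by apply: uae1 => i xi; congr (f i); apply/ffunP => b; rewrite !ffunE.
Qed.

Definition ultra_charts (charts : forall i, set (model Phi (L i) -> X i)) :
    set (model Phi (ultra_module mu L) -> ultraproduct mu X) :=
  [set g | exists2 f : forall i, model Phi (L i) -> X i,
    (forall i, charts i (f i)) & g = ultra_chart f].

End UltraBuilding.

Arguments ultra_charts {R P F n Phi I} mu {L X} charts.

(* Main.v *)
(* By Los' theorem: every axiom only involves finitely many data of each       *)
(* building, provided these are described independently of the value group.   *)
(* The spherical Weyl group is finite and acts by the same F-matrices on all  *)
(* model spaces, so an ultraproduct of affine Weyl group elements has a       *)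
(* constant linear part almost everywhere. A convex set needs at most one     *)
(* half-space [k <= <x, a^v>] per root, so an ultraproduct of convex sets is  *)
(* again convex although the numbers of half-apartments given at first may    *)
(* be unbounded. In (A4) and (A6) one passes between the ultraproduct and its *)
(* factors by internal sets, which determine their components almost          *)
(* everywhere. The metric axioms hold in any building, the triangle           *)
(* inequality coming from the retractions (A5).                               *)
Require Import Defs.
From HB Require Import structures.
From mathcomp Require Import all_boot all_order all_algebra.
From mathcomp Require Import finmap generic_quotient.
From mathcomp Require Import mathcomp_extra boolp classical_sets cardinality reals.
From mathcomp Require Import ring.

Set Implicit Arguments.
Unset Strict Implicit.
Unset Printing Implicit Defensive.

Import Order.TTheory GRing.Theory Num.Theory.

Local Open Scope fset_scope.
Local Open Scope classical_set_scope.
Local Open Scope ring_scope.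

(* [fingraph] also has a constant [roots]. *)
Local Notation roots := Defs.roots.

(** The transfer is done by hand. [pairing_ucl], [images_act_ucl] and [model_dist_ucl] show that the
    structure of the model space is computed componentwise. Statements then pass through finite
    conjunctions by [uae_fin], through existence by [uae_choice] and through a choice among finitely
    many cases by [uae_pigeonhole].

    The last is needed where data could vary without bound with the index. [affine_weylE] and
    [convexP] code affine Weyl group elements and convex sets by a member of a fixed finite type and
    finitely many entries in the value group; [affine_weyl_ucl] and [convex_internal] fix the finite
    part on a set of full measure, which yields (A2). For (A3), (A4) and (A5) the charts,
    sub-chambers and retractions of the factors are assembled componentwise, (A5) resting on the
    componentwise formula [ultra_bld_distE] for the distance. The hypotheses of (A6) concern
    intersections in the ultraproduct; [internal_inj] brings them down to almost all factors. The
    metric is [bld_dist] of the ultraproduct itself, to which [bld_dist_metric] applies once it is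
    known to be a building. *)

(** * Ordered modules and absolute values *)

Section OrderedModule.
Variables (R : realType) (P : pred R) (F : subFieldType P) (L : orderedModType F).
Implicit Types x y z t : L.

Lemma ordmod_le_total x y : x <= y \/ y <= x.
Proof. by have /orP := ordmod_total x y. Qed.

Lemma ordmod_leD2 x y z t : x <= y -> z <= t -> x + z <= y + t.
Proof.
move=> xy zt; apply: le_trans (ordmod_leD _ _ z xy) _.
by rewrite ![y + _]addrC; apply: ordmod_leD.
Qed.

Lemma ordmod_subr_ge0 x y : (0 <= y - x) = (x <= y).
Proof.
by apply/idP/idP => [/(ordmod_leD _ _ x)|/(ordmod_leD _ _ (- x))];
  rewrite ?add0r ?subrK ?subrr.
Qed.

Lemma ordmod_sumr_ge0 (T : Type) (s : seq T) (Q : pred T) (f : T -> L) :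
  (forall i, Q i -> 0 <= f i) -> 0 <= \sum_(i <- s | Q i) f i.
Proof.
move=> f0; elim/big_ind: _ => // x y x0 y0.
by rewrite -[0]addr0 ordmod_leD2.
Qed.

Lemma ordmod_ler_sum (T : Type) (s : seq T) (Q : pred T) (f g : T -> L) :
  (forall i, Q i -> f i <= g i) ->
  \sum_(i <- s | Q i) f i <= \sum_(i <- s | Q i) g i.
Proof. by move=> fg; elim/big_ind2: _ => // *; apply: ordmod_leD2. Qed.

Lemma ordmod_psumr_eq0 (T : eqType) (s : seq T) (Q : pred T) (f : T -> L) :
  (forall i, Q i -> 0 <= f i) -> \sum_(i <- s | Q i) f i = 0 ->
  forall i, i \in s -> Q i -> f i = 0.
Proof.
move=> f0; elim: s => // j s IHs; rewrite big_cons => sum0 i.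
have s0 := ordmod_sumr_ge0 s f0.
have [Qj|nQj] := boolP (Q j); last first.
  rewrite (negbTE nQj) in sum0; rewrite inE => /orP[/eqP-> Qj|]; last exact: IHs.
  by rewrite Qj in nQj.
rewrite Qj in sum0; have fj0 : f j = 0.
  apply/le_anti; rewrite f0 // andbT -ordmod_subr_ge0 sub0r.
  by rewrite (addr0_eq sum0).
rewrite inE => /orP[/eqP-> //|]; apply: IHs.
by rewrite -[LHS]add0r -{1}fj0.
Qed.

(** Multiplication by 2 is invertible over [F]. This allows distances to be compared through their
    doubles, which are sums over all roots. *)
Lemma ordmod_double_inj : injective (fun x : L => x + x).
Proof.
have two_neq0 : (2%:R : F) != 0.
  by rewrite -(fmorph_eq0 (\val : F -> R)) rmorph_nat pnatr_eq0.
move=> x y /(congr1 (GRing.scale (2%:R^-1 : F))).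
by rewrite -!mulr2n -!(scaler_nat 2) !scalerA mulVf // !scale1r.
Qed.

Lemma ordmod_oppr_ge0 x : (0 <= - x) = (x <= 0).
Proof. by rewrite -[- x]sub0r ordmod_subr_ge0. Qed.

Lemma ler0_absm x : x <= 0 -> absm x = - x.
Proof.
move=> x0; have xNx : x <= - x by apply: (le_trans x0); rewrite ordmod_oppr_ge0.
by rewrite /absm /Order.max lt_def xNx andbT; case: eqP.
Qed.

Lemma absmN x : absm (- x) = absm x.
Proof.
rewrite /absm opprK /Order.max; have [xNx|Nxx] := ordmod_le_total x (- x).
  by rewrite [in RHS]lt_def [in LHS]lt_leAnge xNx andbF andbT; case: eqP.
by rewrite [in LHS]lt_def [in RHS]lt_leAnge Nxx andbF andbT eq_sym; case: eqP => // ->.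
Qed.

Lemma ger0_absm x : 0 <= x -> absm x = x.
Proof. by rewrite -[x]opprK ordmod_oppr_ge0 => x0; rewrite absmN ler0_absm. Qed.

Lemma absm0 : absm (0 : L) = 0.
Proof. exact: ger0_absm. Qed.

Lemma absm_ge0 x : 0 <= absm x.
Proof.
have [x0|x0] := ordmod_le_total 0 x; first by rewrite ger0_absm.
by rewrite ler0_absm // ordmod_oppr_ge0.
Qed.

Lemma absm_eq0 x : absm x = 0 -> x = 0.
Proof.
have [x0|x0] := ordmod_le_total 0 x; first by rewrite ger0_absm.
by rewrite ler0_absm // => Nx0; rewrite -[x]opprK Nx0 oppr0.
Qed.

Lemma le_absm x : x <= absm x.
Proof.
have [x0|x0] := ordmod_le_total 0 x; first by rewrite ger0_absm.
exact: le_trans (absm_ge0 x).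
Qed.

Lemma absm_triangle x y : absm (x + y) <= absm x + absm y.
Proof.
have [xy0|xy0] := ordmod_le_total 0 (x + y).
  by rewrite ger0_absm //; apply: ordmod_leD2; apply: le_absm.
rewrite ler0_absm // opprD -(absmN x) -(absmN y).
by apply: ordmod_leD2; apply: le_absm.
Qed.

End OrderedModule.

(** * Roots and reflections over the reals *)

Section Roots.
Variables (R : realType) (n : nat).
Implicit Types u v a : 'rV[R]_n.

Definition root_reflection a u : 'rV[R]_n := u - coroot_eval u a *: a.

Lemma coroot_evalDl u v a : coroot_eval (u + v) a = coroot_eval u a + coroot_eval v a.
Proof. by rewrite /coroot_eval dotDl mulrDr mulrDl. Qed.

Lemma coroot_evalZl c u a : coroot_eval (c *: u) a = c * coroot_eval u a.
Proof. by rewrite /coroot_eval dotZl mulrCA !mulrA. Qed.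

Lemma coroot_evalNl u a : coroot_eval (- u) a = - coroot_eval u a.
Proof. by rewrite -scaleN1r coroot_evalZl mulN1r. Qed.

Lemma dotNr u v : dot u (- v) = - dot u v.
Proof. by rewrite dotC -scaleN1r dotZl mulN1r dotC. Qed.

Lemma coroot_evalNr u a : coroot_eval u (- a) = - coroot_eval u a.
Proof.
by rewrite /coroot_eval !dotNr [dot (- a) a]dotC dotNr opprK mulrN mulNr.
Qed.

Lemma coroot_eval_self a : a != 0 -> coroot_eval a a = 2.
Proof. by move=> a0; rewrite /coroot_eval mulfK // gt_eqF ?dot_gt0. Qed.

Lemma root_reflectionK a : a != 0 -> involutive (root_reflection a).
Proof.
move=> a0 u; rewrite /root_reflection coroot_evalDl coroot_evalNl coroot_evalZl.
rewrite coroot_eval_self // (_ : _ - _ * 2 = - coroot_eval u a); last by ring.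
by rewrite scaleNr opprK subrK.
Qed.

Lemma dot_root_reflection a u v : a != 0 ->
  dot (root_reflection a u) (root_reflection a v) = dot u v.
Proof.
move=> a0; have aa : dot a a != 0 by rewrite gt_eqF ?dot_gt0.
rewrite /root_reflection -!scaleNr !dotDl !dotZl ![dot _ (v + _)]dotC !dotDl !dotZl.
by rewrite (dotC v u) (dotC a u) /coroot_eval ?(dotC a v) /coroot_eval; field.
Qed.

(** A reflection is an isometry and an involution, hence self-adjoint. *)
Lemma coroot_eval_reflection a u v : a != 0 ->
  coroot_eval (root_reflection a u) v = coroot_eval u (root_reflection a v).
Proof.
move=> a0; rewrite -[v in LHS](root_reflectionK a0) /coroot_eval.
by rewrite !dot_root_reflection.
Qed.

Variable Phi : root_system R n.

Lemma roots_neq0 a : a \in roots Phi -> a != 0.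
Proof. by move=> aR; apply: contraNneq (root_neq0 Phi) => <-. Qed.

Lemma roots_reflection a u : a \in roots Phi -> u \in roots Phi ->
  root_reflection a u \in roots Phi.
Proof. exact: root_refl. Qed.

Lemma roots_opp a : a \in roots Phi -> - a \in roots Phi.
Proof.
move=> aR; have := roots_reflection aR aR.
rewrite /root_reflection coroot_eval_self ?roots_neq0 //.
by rewrite scaler_nat mulr2n opprD addrA subrr add0r.
Qed.

Lemma base_root (b : base Phi) : \val b \in roots Phi.
Proof. exact: base_roots (valP b). Qed.

Lemma base_sum (b : base Phi) : \val b = \sum_b' (b' == b)%:R *: \val b'.
Proof.
rewrite (bigD1 b) //= eqxx scale1r big1 ?addr0 // => b0 /negbTE->.
by rewrite scale0r.
Qed.

Lemma base_positive (b : base Phi) : positive_root Phi (\val b).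
Proof.
split; first exact: base_root.
by exists (fun b' => (b' == b)%:R); split; [exact: base_sum|move=> b'; exact: ler0n].
Qed.

(** The base is free, so a root whose coordinates were both all nonnegative and all nonpositive
    would vanish; [base_sign] gives at least one of the two signs. *)
Lemma positive_root_oppP a : a \in roots Phi ->
  positive_root Phi (- a) <-> ~ positive_root Phi a.
Proof.
move=> aR; split=> [[_ [c [cE c0]]] [_ [e [eE e0]]]|nposa].
  have /negP := roots_neq0 aR; apply; apply/eqP.
  have ce b : e b = - c b.
    by rewrite -(base_coordE e) -eE -[a]opprK cE -sumrN -(base_coordE (fun b => - c b));
      congr base_coord; apply: eq_bigr => b' _; rewrite scaleNr.
  rewrite eE big1 // => b _; rewrite (_ : e b = 0) ?scale0r //.
  by apply/le_anti; rewrite e0 andbT ce oppr_le0.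
split; first exact: roots_opp.
have [c [cE [c0|c0]]] := base_sign aR; first by case: nposa; split=> //; exists c.
exists (fun b => - c b); split=> [|b]; last by rewrite oppr_ge0.
by rewrite cE -sumrN; apply: eq_bigr => b _; rewrite scaleNr.
Qed.

End Roots.

(** * Root coordinates and co-root evaluations in the subfield [F] *)

Section Coordinates.
Variables (R : realType) (P : pred R) (F : subFieldType P) (n : nat).
Variables (Phi : root_system R n) (hF : contains_coroot_evals Phi P).
Implicit Types u v a : 'rV[R]_n.

(** The coefficient occurring in [pairing]. On roots [hF] keeps [insubd] away from its default
    value, so identities can be checked in the reals. *)
Definition coroot_evalF u a : F := insubd (0 : F) (coroot_eval u a).

Lemma val_coroot_evalF u a : u \in roots Phi -> a \in roots Phi ->
  (\val (coroot_evalF u a) : R) = coroot_eval u a.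
Proof. by move=> uR aR; rewrite insubdK //; apply: hF. Qed.

Lemma val_root_coord u b : u \in roots Phi ->
  (\val (root_coord F Phi u b) : R) = base_coord b u.
Proof.
by move=> uR; rewrite [in RHS](root_coordE F hF uR) base_coordE.
Qed.

Lemma root_coord_reflection a u b : a \in roots Phi -> u \in roots Phi ->
  root_coord F Phi (root_reflection a u) b =
  root_coord F Phi u b - coroot_evalF u a * root_coord F Phi a b.
Proof.
move=> aR uR; apply: val_inj; rewrite val_root_coord ?roots_reflection //.
rewrite rmorphB rmorphM /= !val_root_coord // val_coroot_evalF //.
by rewrite /base_coord linearB linearZ.
Qed.

Lemma root_coord_base (b b' : base Phi) :
  root_coord F Phi (\val b) b' = (b' == b)%:R.
Proof.
apply: val_inj; rewrite val_root_coord ?base_root // base_sum base_coordE.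
by rewrite rmorph_nat.
Qed.

Lemma coroot_evalF_sum u a : u \in roots Phi -> a \in roots Phi ->
  coroot_evalF u a = \sum_b root_coord F Phi u b * coroot_evalF (\val b) a.
Proof.
move=> uR aR; apply: (val_inj : injective (\val : F -> R)).
rewrite rmorph_sum val_coroot_evalF //=.
rewrite [in LHS](root_coordE F hF uR) /coroot_eval dot_suml mulr_sumr mulr_suml.
apply: eq_bigr => b _; rewrite rmorphM /= val_coroot_evalF ?base_root //.
by rewrite /coroot_eval mulrCA !mulrA.
Qed.

Lemma coroot_evalF_reflectionr u a v :
  u \in roots Phi -> a \in roots Phi -> v \in roots Phi ->
  coroot_evalF u (root_reflection a v) =
  coroot_evalF u v - coroot_evalF u a * coroot_evalF a v.
Proof.
move=> uR aR vR; apply: (val_inj : injective (\val : F -> R)).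
rewrite rmorphB rmorphM /= !val_coroot_evalF ?roots_reflection //.
rewrite -coroot_eval_reflection ?(roots_neq0 aR) //.
by rewrite coroot_evalDl coroot_evalNl coroot_evalZl.
Qed.

Lemma coroot_evalF_self a : a \in roots Phi -> coroot_evalF a a = 2.
Proof.
move=> aR; apply: (val_inj : injective (\val : F -> R)).
rewrite val_coroot_evalF // coroot_eval_self; last exact: roots_neq0 aR.
by rewrite rmorph_nat.
Qed.

Lemma coroot_evalFNr u a : u \in roots Phi -> a \in roots Phi ->
  coroot_evalF u (- a) = - coroot_evalF u a.
Proof.
move=> uR aR; apply: (val_inj : injective (\val : F -> R)).
by rewrite rmorphN /= !val_coroot_evalF ?roots_opp // coroot_evalNr.
Qed.

(* A linear relation between the rows of the Cartan matrix gives a vector of  *)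
(* the span of the base that is orthogonal to the base, hence to itself.      *)
Lemma cartan_matrix_left_inverse : exists N : base Phi -> base Phi -> F,
  forall b b', \sum_c coroot_evalF (\val b) (\val c) * N c b' = (b == b')%:R.
Proof.
pose m := #|{: base Phi}|.
pose M : 'M[F]_m :=
  \matrix_(i, j) coroot_evalF (\val (enum_val i)) (\val (enum_val j)).
have freeM : row_free M.
  rewrite -kermx_eq0; apply/rowV0P => v /sub_kermxP vM0.
  pose w b : R := \val (v 0 (enum_rank b)).
  pose u : 'rV[R]_n := \sum_b w b *: \val b.
  have ub (b : base Phi) : dot u (\val b) = 0.
    have /rowP/(_ (enum_rank b)) := vM0; rewrite !mxE.
    move/(congr1 (\val : F -> R)); rewrite rmorph0 rmorph_sum /= => sum0.
    have : coroot_eval u (\val b) = 0.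
      rewrite -sum0 /coroot_eval dot_suml mulr_sumr mulr_suml.
      rewrite (reindex _ (onW_bij _ (@enum_val_bij (base Phi)))) /=.
      apply: eq_bigr => i _; rewrite mxE enum_rankK rmorphM /= val_coroot_evalF ?base_root // /w enum_valK.
      by rewrite /coroot_eval mulrCA !mulrA.
    rewrite /coroot_eval => /eqP; rewrite !mulf_eq0 pnatr_eq0 invr_eq0 /=.
    by rewrite (gt_eqF (dot_gt0 (roots_neq0 (base_root b)))) orbF => /eqP.
  have u0 : u = 0.
    apply: contra_eq (erefl (dot u u)) => /dot_gt0.
    by rewrite {1}/u dot_suml big1 ?ltxx // => b _; rewrite dotC ub mulr0.
  apply/rowP => i; rewrite mxE; apply: (val_inj : injective (\val : F -> R)).
  rewrite rmorph0 -(enum_valK i) -/(w _) -(base_coordE w) -/u u0.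
  by rewrite /base_coord linear0.
exists (fun b b' => invmx M (enum_rank b) (enum_rank b')) => b b'.
have /mulmxV : M \in unitmx by rewrite -row_free_unit.
move/matrixP/(_ (enum_rank b) (enum_rank b')).
rewrite !mxE (inj_eq enum_rank_inj) => <-.
rewrite (reindex _ (onW_bij _ (@enum_val_bij (base Phi)))) /=; apply: eq_bigr => i _.
by rewrite mxE enum_rankK enum_valK.
Qed.

End Coordinates.

(** * The Weyl group action on the model space *)

Section WeylImages.
Variables (R : realType) (n : nat) (Phi : root_system R n).

(* The images of the base under the elements of the spherical Weyl group: an  *)
(* encoding of that group which does not depend on the value group and lives  *)
(* in a finite type.                                                           *)
Inductive weyl_images : {ffun base Phi -> roots Phi} -> Prop :=
| weyl_images_id (p : {ffun base Phi -> roots Phi}) :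
    (forall b, \val (p b) = \val b) -> weyl_images p
| weyl_images_refl a (p q : {ffun base Phi -> roots Phi}) :
    a \in roots Phi -> weyl_images p ->
    (forall b, \val (q b) = root_reflection a (\val (p b))) -> weyl_images q.

End WeylImages.

Section ModelSpace.
Variables (R : realType) (P : pred R) (F : subFieldType P) (n : nat).
Variables (Phi : root_system R n) (hF : contains_coroot_evals Phi P).
Variable L : orderedModType F.
Local Notation A := (model Phi L).
Local Notation "<< u , a >>" := (coroot_evalF F u a).
Implicit Types (x y t : A) (a u : 'rV[R]_n) (p q : {ffun base Phi -> roots Phi}).

Lemma pairingD x y a : pairing (x + y) a = pairing x a + pairing y a.
Proof.
by rewrite /pairing -big_split; apply: eq_bigr => b _; rewrite ffunE scalerDr.
Qed.

Lemma pairingN x a : pairing (- x) a = - pairing x a.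
Proof.
by rewrite /pairing -sumrN; apply: eq_bigr => b _; rewrite ffunE scalerN.
Qed.

Lemma pairingB x y a : pairing (x - y) a = pairing x a - pairing y a.
Proof. by rewrite pairingD pairingN. Qed.

Lemma pairing0 a : pairing (0 : A) a = 0.
Proof. by rewrite -(subrr 0) pairingB subrr. Qed.

Lemma pairing_root u a (l : L) : u \in roots Phi -> a \in roots Phi ->
  pairing [ffun b => root_coord F Phi u b *: l] a = <<u, a>> *: l.
Proof.
move=> uR aR; rewrite (coroot_evalF_sum F hF uR aR) scaler_suml.
by apply: eq_bigr => b _; rewrite ffunE scalerA mulrC.
Qed.

Lemma pairing_oppr x a : a \in roots Phi -> pairing x (- a) = - pairing x a.
Proof.
move=> aR; rewrite -sumrN; apply: eq_bigr => b _.
by rewrite -/(coroot_evalF F _ _) (coroot_evalFNr F hF (base_root b) aR) scaleNr.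
Qed.

Lemma pairing_onto a (l : L) : a \in roots Phi -> exists t, pairing t a = l.
Proof.
(* The factor 1/2 compensates [<a, a^v> = 2]. *)
move=> aR; exists [ffun b => root_coord F Phi a b *: ((2 : F)^-1 *: l)].
rewrite pairing_root // (coroot_evalF_self F hF aR) scalerA divff ?scale1r //.
by rewrite -(fmorph_eq0 (\val : F -> R)) rmorph_nat pnatr_eq0.
Qed.

(** The inverse of the Cartan matrix over [F] recovers the coordinates of [x] from these pairings.
    It is what makes [model_dist] separate points. *)
Lemma pairing_base_inj x : (forall b : base Phi, pairing x (\val b) = 0) -> x = 0.
Proof.
move=> x0; have [N NE] := cartan_matrix_left_inverse F hF.
apply/ffunP => b; rewrite ffunE.
have : \sum_c N c b *: pairing x (\val c) = 0.
  by rewrite big1 // => c _; rewrite x0 scaler0.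
rewrite /pairing; under eq_bigr do rewrite scaler_sumr.
rewrite exchange_big (bigD1 b) //= [X in _ + X]big1 => [|b' b'b].
  rewrite addr0; under eq_bigr do rewrite scalerA mulrC.
  by rewrite -scaler_suml NE eqxx scale1r.
under eq_bigr do rewrite scalerA mulrC.
by rewrite -scaler_suml NE (negbTE b'b) scale0r.
Qed.

Lemma reflD a x y : refl a (x + y) = refl a x + refl a y.
Proof.
apply/ffunP => b; rewrite !ffunE pairingD scalerDr opprD.
by rewrite -!addrA; congr (_ + _); rewrite addrCA.
Qed.

(** Reflections permute the functionals [<., u^v>] as they permute the roots; half-spaces and the
    metric are handled through this. *)
Lemma refl_pairing a u x : a \in roots Phi -> u \in roots Phi ->
  pairing (refl a x) u = pairing x (root_reflection a u).
Proof.
move=> aR uR; rewrite /refl pairingB pairing_root //.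
rewrite [X in X - _]/pairing [X in _ - _ *: X]/pairing scaler_sumr -sumrB.
apply: eq_bigr => b _; rewrite -!/(coroot_evalF F _ _).
rewrite (coroot_evalF_reflectionr F hF (base_root b) aR uR).
by rewrite scalerA -scalerBl mulrC.
Qed.

Lemma reflK a : a \in roots Phi -> involutive (@refl R P F n Phi L a).
Proof.
move=> aR x; rewrite /refl pairingB pairing_root // (coroot_evalF_self F hF aR).
rewrite scaler_nat mulr2n opprD addrA subrr sub0r.
by apply/ffunP => b; rewrite !ffunE scalerN opprK subrK.
Qed.

(** The linear extension of the map sending each base root [b] to [p b]. Its coefficients lie in
    [F], so one [p] acts on the model spaces of all value groups. *)
Definition images_act p x : A :=
  [ffun b => \sum_b' root_coord F Phi (\val (p b')) b *: x b'].

Lemma images_act_id p : (forall b, \val (p b) = \val b) -> images_act p =1 id.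
Proof.
move=> pE x; apply/ffunP => b; rewrite ffunE (bigD1 b) //= big1 => [|b' b'b].
  by rewrite pE (root_coord_base F hF) eqxx scale1r addr0.
by rewrite pE (root_coord_base F hF) eq_sym (negbTE b'b) scale0r.
Qed.

Lemma images_act_pairing p x a : a \in roots Phi ->
  pairing (images_act p x) a = \sum_b << \val (p b), a >> *: x b.
Proof.
move=> aR; rewrite /pairing; under eq_bigr do rewrite ffunE scaler_sumr.
rewrite exchange_big; apply: eq_bigr => b _ /=.
rewrite (coroot_evalF_sum F hF (valP (p b)) aR) scaler_suml.
by apply: eq_bigr => b' _; rewrite scalerA mulrC.
Qed.

Lemma images_act_refl a p q : a \in roots Phi ->
  (forall b, \val (q b) = root_reflection a (\val (p b))) ->
  images_act q =1 refl a \o images_act p.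
Proof.
move=> aR qE x; apply/ffunP => b; rewrite !ffunE images_act_pairing //.
rewrite scaler_sumr -sumrB; apply: eq_bigr => b' _.
rewrite qE (root_coord_reflection F hF _ aR (valP (p b'))).
by rewrite scalerBl scalerA mulrC.
Qed.

Lemma spherical_weylP (w : A -> A) :
  spherical_weyl w <-> exists2 p, weyl_images p & w = images_act p.
Proof.
split=> [|[p pP ->]].
  elim=> [|a w' aR _ [p pP ->]].
    pose p : {ffun base Phi -> roots Phi} := [ffun b => [` base_root b]].
    have pE b : \val (p b) = \val b by rewrite ffunE.
    exists p; first exact: weyl_images_id.
    by apply/esym/funext; exact: images_act_id.
  pose q : {ffun base Phi -> roots Phi} :=
    [ffun b => [` roots_reflection aR (valP (p b))]].
  have qE b : \val (q b) = root_reflection a (\val (p b)) by rewrite ffunE.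
  exists q; first exact: weyl_images_refl pP qE.
  by apply/esym/funext; exact: images_act_refl.
elim: pP => [{}p pE|a {}p q aR _ IHp qE].
  by rewrite (_ : images_act p = id); [constructor|apply/funext/images_act_id].
rewrite (_ : images_act q = refl a \o images_act p); first by constructor.
exact/funext/images_act_refl.
Qed.

Lemma affine_weylE (w : A -> A) :
  affine_weyl w <-> exists p t, weyl_images p /\ w = (fun x => images_act p x + t).
Proof.
split=> [[_ [t [/spherical_weylP[p pW ->] ->]]]|[p [t [pW ->]]]].
  by exists p, t.
by exists (images_act p), t; split=> //; apply/spherical_weylP; exists p.
Qed.

Lemma spherical_weylD (w : A -> A) x y : spherical_weyl w -> w (x + y) = w x + w y.
Proof. by move=> sw; elim: sw x y => //= a v aR _ IH x y; rewrite IH reflD. Qed.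

Lemma affine_weyl_id : affine_weyl (id : A -> A).
Proof. by exists id, 0; split; [constructor|apply/funext => x; rewrite addr0]. Qed.

Lemma affine_weyl_trans t : affine_weyl (fun x : A => x + t).
Proof. by exists id, t; split=> //; constructor. Qed.

(* Reflections permute the half-spaces [k <= <x, a^v>], and every [k] is the  *)
(* value of [<., a^v>] at some translation vector.                            *)
Lemma half_apartmentP (H : set A) : half_apartment H <->
  exists a k, a \in roots Phi /\ H = [set x | k <= pairing x a].
Proof.
split=> [[_ [a [[v [t [sv ->]]] aR ->]]]|[a [k [aR ->]]]]; last first.
  have [t tE] := pairing_onto k aR.
  exists (fun x => x + t), a; split=> //; first exact: affine_weyl_trans.
  apply/seteqP; split=> [x /= kx|_ [x /= x0 <-]].
    exists (x - t); last by rewrite subrK.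
    by rewrite /= pairingB tE ordmod_subr_ge0.
  by rewrite pairingD tE addrC -ordmod_subr_ge0 addrAC subrr add0r.
have [a' a'R aa'] : exists2 a', a' \in roots Phi &
    v @` [set x | 0 <= pairing x a] = [set x | 0 <= pairing x a'].
  elim: sv => [|b {}v bR _ [a' a'R IH]]; first by exists a; rewrite ?image_id.
  exists (root_reflection b a'); first exact: roots_reflection.
  rewrite -image_comp IH; apply/seteqP; split=> [_ [x /= x0 <-]|x /= x0].
    by rewrite -refl_pairing // reflK.
  by exists (refl b x); rewrite /= ?refl_pairing ?reflK.
exists a', (pairing t a'); split=> //.
rewrite (_ : (fun x => _) = (fun x => x + t) \o v) // -image_comp aa'.
apply/seteqP; split=> [_ [x /= x0 <-]|x /= x0].
  by rewrite pairingD -ordmod_subr_ge0 addrK.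
by exists (x - t); rewrite /= ?subrK // pairingB ordmod_subr_ge0.
Qed.

End ModelSpace.

(** * Convex sets and the metric of the model space *)

Section ModelMetric.
Variables (R : realType) (P : pred R) (F : subFieldType P) (n : nat).
Variables (Phi : root_system R n) (hF : contains_coroot_evals Phi P).
Variable L : orderedModType F.
Local Notation A := (model Phi L).
Implicit Types (x y z t : A) (C : set A).

(* A finite intersection of half-apartments involves at most one half-space   *)
(* for each root, since those of a given root are nested.                     *)
Lemma convexP C : convex C <->
  exists (e : bool) (D : {set roots Phi}) (k : roots Phi -> L),
    C = [set x | e /\ forall a, a \in D -> k a <= pairing x (\val a)].
Proof.
(* A false flag [e] encodes the empty set. *)
split=> [[->|[Hs [/finite_seqP[s ->] Hhalf ->]]]|[[] [D [k ->]]]]; last 2 first.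
- right; exists ((fun a : roots Phi => [set x | k a <= pairing x (\val a)]) @`
                   [set` D]); split.
  + by apply: finite_image; exact: finite_finset.
  + move=> _ [a _ <-]; apply/(half_apartmentP hF); exists (\val a), (k a).
    by split=> //; exact: valP.
  + apply/seteqP; split=> [x /= [_ xD] _ [a aD <-]|x xD] /=; first exact: xD.
    by split=> // a aD; apply: (xD [set y | k a <= pairing y (\val a)]); exists a.
- by left; apply/seteqP; split=> x // -[].
- by exists false, finset.set0, (fun=> 0); apply/seteqP; split=> x // -[].
have {}Hhalf H : H \in s -> half_apartment H by apply: Hhalf.
suff [D [k DE]] : exists (D : {set roots Phi}) k, forall x,
    (forall H, H \in s -> H x) <-> forall a, a \in D -> k a <= pairing x (\val a).
  exists true, D, k; apply/seteqP; split=> x /=.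
    by move=> xs; split=> //; apply/DE => H sH; apply: xs.
  by move=> [_ /DE xD] H; apply: xD.
elim: s Hhalf => [|H s IHs] Hhalf.
  by exists finset.set0, (fun=> 0) => x; split=> // _ a; rewrite inE.
have [|D [k DE]] := IHs; first by move=> H' H's; apply: Hhalf; rewrite inE H's orbT.
have /(half_apartmentP hF)[a [l [aR HE]]] := Hhalf _ (mem_head H s).
pose c : roots Phi := [` aR].
(* If [c] already carries a bound, the larger of the two bounds is kept. *)
pose m := if c \in D then (if l <= k c then k c else l) else l.
exists (c |: D)%SET, (fun d => if d == c then m else k d) => x.
have mE : m <= pairing x a <->
    l <= pairing x a /\ (c \in D -> k c <= pairing x a).
  rewrite /m; case: ifP => cD; last by split=> [|[]].
  have [lk|lk] := boolP (l <= k c).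
    by split=> [mx|[_]]; [split=> //; apply: le_trans mx|apply].
  have kl : k c <= l by have [] := ordmod_le_total l (k c) => // /(elimN idP lk).
  by split=> [lx|[]//]; split=> // _; apply: le_trans lx.
split=> [xHs d|xD H'].
  have xD : forall d, d \in D -> k d <= pairing x (val d).
    by apply/DE => H' H's; apply: xHs; rewrite inE H's orbT.
  have lx : l <= pairing x a by have := xHs _ (mem_head H s); rewrite HE.
  rewrite !inE; case: eqP => [-> _|_ /=]; last exact: xD.
  by apply/mE; split=> // /xD.
have xm : m <= pairing x a by have := xD c; rewrite !inE eqxx; apply.
have /mE[lx kx] := xm; rewrite inE => /predU1P[->|]; first by rewrite HE.
apply/DE: H' => d dD; have [dc|dc] := eqVneq d c.
  by rewrite dc; apply: kx; rewrite -dc.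
by have := xD d; rewrite !inE dD orbT (negbTE dc); apply.
Qed.

(** Summing over all roots instead of the positive ones makes invariance under reflections a mere
    reindexing. *)
Definition root_norm z : L := \sum_(a : roots Phi) absm (pairing z (\val a)).

(** Exactly one of [a] and [- a] is positive, and both contribute the same absolute value. *)
Lemma model_dist_double x y : model_dist x y + model_dist x y = root_norm (y - x).
Proof.
rewrite /root_norm (bigID (fun a : roots Phi => `[< positive_root Phi (\val a) >])) /=.
rewrite {1 2}/model_dist !big_seq_fsetE /=; congr (_ + _).
pose opp (a : roots Phi) : roots Phi := [` roots_opp (valP a)].
have oppK : involutive opp by move=> a; apply: val_inj; rewrite /= opprK.
rewrite [RHS](reindex_inj (inv_inj oppK)) /=; apply: eq_big => [a|a _].
  apply/asboolP/asboolPn; last first.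
    by move=> /(positive_root_oppP (roots_opp (valP a))); rewrite opprK.
  by move=> pa /(positive_root_oppP (valP a)).
by rewrite (pairing_oppr hF _ (valP a)) absmN.
Qed.

Lemma root_norm_refl a z : a \in roots Phi -> root_norm (refl a z) = root_norm z.
Proof.
move=> aR; pose r (u : roots Phi) : roots Phi := [` roots_reflection aR (valP u)].
have rK : involutive r.
  by move=> u; apply: val_inj; rewrite /= root_reflectionK // (roots_neq0 aR).
rewrite [RHS](reindex_inj (inv_inj rK)); apply: eq_bigr => u _.
by rewrite (refl_pairing hF _ aR (valP u)).
Qed.

Lemma model_dist_affine_weyl (w : A -> A) x y :
  affine_weyl w -> model_dist (w x) (w y) = model_dist x y.
Proof.
move=> [v [t [sv ->]]]; apply: ordmod_double_inj; rewrite !model_dist_double.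
rewrite opprD addrACA subrr addr0.
have -> : v y - v x = v (y - x).
  by apply/eqP; rewrite subr_eq -(spherical_weylD _ _ sv) subrK.
elim: sv (y - x) => // a {}v aR _ IH z /=; by rewrite root_norm_refl.
Qed.

Lemma model_dist_metric : is_metric (@model_dist R P F n Phi L).
Proof.
split=> [x y|x y|x y|x y z].
- by apply: ordmod_sumr_ge0 => a _; exact: absm_ge0.
- split=> [d0|->]; last by apply: big1 => a _; rewrite subrr pairing0 absm0.
  apply/esym/eqP; rewrite -subr_eq0; apply/eqP/(pairing_base_inj hF) => b.
  apply: absm_eq0; apply: (ordmod_psumr_eq0 _ d0).
  + by move=> *; exact: absm_ge0.
  + exact: base_root.
  + by apply/asboolP; exact: base_positive.
- by apply: eq_bigr => a _; rewrite -opprB pairingN absmN.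
- rewrite /model_dist -big_split; apply: ordmod_ler_sum => a _.
  have -> : z - x = (y - x) + (z - y) by rewrite [RHS]addrC addrA subrK.
  by rewrite pairingD; exact: absm_triangle.
Qed.

End ModelMetric.

(** * The metric of a building *)

Section BuildingMetric.
Variables (R : realType) (P : pred R) (F : subFieldType P) (n : nat).
Variables (Phi : root_system R n) (hF : contains_coroot_evals Phi P).
Variables (L : orderedModType F) (X : Type) (charts : set (model Phi L -> X)).

(** Independence of the chart: transition maps lie in the affine Weyl group, which preserves
    [model_dist]. Assuming only injectivity and the transition part of (A2) makes this available for
    the ultraproduct before (A5) is proved there. *)
Lemma bld_distE f a b :
  (forall f, charts f -> injective f) ->
  (forall f g, charts f -> charts g -> exists2 w, affine_weyl w &
     forall x, range g (f x) -> f x = g (w x)) ->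
  charts f -> bld_dist charts (f a) (f b) = model_dist a b.
Proof.
move=> inj A2 cf; rewrite /bld_dist; case: xgetP => [_ _ [g [a' [b' [cg ga gb ->]]]]|].
  have [w aw fw] := A2 _ _ cf cg.
  have /(inj _ cg) -> : g a' = g (w a) by rewrite ga fw //; exists a'.
  have /(inj _ cg) -> : g b' = g (w b) by rewrite gb fw //; exists b'.
  exact: model_dist_affine_weyl.
by move=> /(_ (model_dist a b)); case; exists f, a, b.
Qed.

(* The triangle inequality is that of an apartment containing [x] and [z],    *)
(* onto which (A5) retracts the third point.                                   *)
Lemma bld_dist_metric : building charts -> is_metric (bld_dist charts).
Proof.
move=> bX; have dE f a b : charts f -> bld_dist charts (f a) (f b) = model_dist a b.
  apply: bld_distE; first exact: chart_inj bX.
  by move=> ? ? cf cg; have [] := building_A2 bX cf cg.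
have [d_ge0 d_eq0 dC d_tri] := model_dist_metric hF L.
have inY x y : exists f a b, [/\ charts f, f a = x & f b = y].
  have [_ [[f cf ->] [a _ <-] [b _ <-]]] := building_A3 bX x y.
  by exists f, a, b.
split=> [x y|x y|x y|x y z].
- by have [f [a [b [cf <- <-]]]] := inY x y; rewrite dE.
- have [f [a [b [cf <- <-]]]] := inY x y; rewrite dE //; split=> [/d_eq0-> //|].
  by move=> /(chart_inj bX cf) ->; apply/d_eq0.
- by have [f [a [b [cf <- <-]]]] := inY x y; rewrite !dE.
have [f [a [c [cf fa fc]]]] := inY x z.
have [||r [rY rK r_le _]] := building_A5 bX (Y := range f) (x := x).
- by exists f.
- by exists a.
have rx : r x = x by apply: rK; exists a.
have rz : r z = z by apply: rK; exists c.
have [b _ fb] := rY y.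
apply: (@le_trans _ _ (bld_dist charts (r x) (r y) + bld_dist charts (r y) (r z))).
  by rewrite rx rz -fb -fa -fc !dE.
exact: ordmod_leD2.
Qed.

End BuildingMetric.

(** * Transfer along the ultrafilter and internal sets *)

Section AlmostEverywhere.
Variables (I : Type) (mu : ultrafilter I).

Lemma uae_ex (Q : I -> Prop) : mu [set i | Q i] -> exists i, Q i.
Proof.
move=> muQ; apply: contrapT => nQ; suff : mu set0 by rewrite umeas0.
by apply: uae1 muQ => i Qi; apply: nQ; exists i.
Qed.

Lemma uaeN (Q : I -> Prop) : mu [set i | ~ Q i] <-> ~ mu [set i | Q i].
Proof. by rewrite -[[set i | ~ Q i]]/(~` [set i | Q i]) umeasC; split=> /negP. Qed.

(** Otherwise all complements of the fibres have full measure, and so has their finite intersection,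
    which is empty. *)
Lemma uae_pigeonhole (T : finType) (t : I -> T) : exists c, mu [set i | t i = c].
Proof.
apply: contrapT => nt; suff /uae_ex[i /(_ (t i))] : mu [set i | forall c, t i <> c] by [].
by apply: uae_fin => c; apply/uaeN => muc; apply: nt; exists c.
Qed.

Variable X : I -> Type.

(** The family [x0] fills in the components where no witness exists. *)
Lemma uae_choice (x0 : forall i, X i) (Q : forall i, X i -> Prop) :
  mu [set i | exists x, Q i x] -> exists x : forall i, X i, mu [set i | Q i (x i)].
Proof.
have ex i : exists x, (exists x, Q i x) -> Q i x.
  by have [[x Qx]|nQ] := pselect (exists x, Q i x); [exists x|exists (x0 i)].
move=> muQ; exists (fun i => sval (cid (ex i))).
by apply: uae1 muQ => i; apply: (svalP (cid (ex i))).
Qed.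

Definition internal (S : forall i, set (X i)) : set (ultraproduct mu X) :=
  [set x | mu [set i | S i (urepr x i)]].

Lemma internal_ucl S (x : forall i, X i) :
  internal S (ucl mu x) <-> mu [set i | S i (x i)].
Proof. by split; apply: uae2 (urepr_ucl mu x) => i ->. Qed.

Lemma internalI S T : internal S `&` internal T = internal (fun i => S i `&` T i).
Proof.
apply/seteqP; split=> x; last by move=> ST; split; apply: uae1 ST => i [].
by move=> [xS xT]; apply: uae2 xS xT => i.
Qed.

(** If the inclusion failed almost everywhere, the class of a family of points of [S i] outside
    [T i] would contradict the inclusion of internal sets. *)
Lemma internal_sub (x0 : forall i, X i) S T :
  internal S `<=` internal T -> mu [set i | S i `<=` T i].
Proof.
move=> ST; apply: contrapT => /uaeN nST.
have [|x xP] := uae_choice x0 (Q := fun i x => S i x /\ ~ T i x).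
  apply: uae1 nST => i nST; apply: contrapT => nx; apply: nST => x Sx.
  by apply: contrapT => nTx; apply: nx; exists x.
have /ST/internal_ucl Tx : internal S (ucl mu x).
  by apply/internal_ucl; apply: uae1 xP => i [].
by have [i [[_ ?]]] := uae_ex (umeasI xP Tx).
Qed.

Lemma internal_inj (x0 : forall i, X i) S T :
  internal S = internal T -> mu [set i | S i = T i].
Proof.
move=> ST; have sST : mu [set i | S i `<=` T i] by apply: internal_sub; rewrite ?ST.
have sTS : mu [set i | T i `<=` S i] by apply: internal_sub; rewrite ?ST.
by apply: uae2 sST sTS => i ? ?; apply/seteqP.
Qed.

End AlmostEverywhere.

(** * The model space over the ultraproduct of the value groups *)

Section UltraModel.
Variables (R : realType) (P : pred R) (F : subFieldType P) (n : nat).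
Variables (Phi : root_system R n) (hF : contains_coroot_evals Phi P).
Variables (I : Type) (mu : ultrafilter I) (L : I -> orderedModType F).
Local Notation M := (ultra_module mu L).
Local Notation A i := (model Phi (L i)).
Local Notation ultraA := (model Phi M).

Lemma ucl_addE (x y : forall i, L i) :
  (ucl mu x : M) + (ucl mu y : M) = ucl mu (fun i => x i + y i).
Proof. exact: ucl_add. Qed.

Lemma ucl_oppE (x : forall i, L i) : - (ucl mu x : M) = ucl mu (fun i => - x i).
Proof. exact: ucl_opp. Qed.

Lemma ucl_scaleE c (x : forall i, L i) :
  c *: (ucl mu x : M) = ucl mu (fun i => c *: x i).
Proof. exact: ucl_scale. Qed.

Lemma ucl_leE (x y : forall i, L i) :
  ((ucl mu x : M) <= (ucl mu y : M)) = mu [set i | x i <= y i].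
Proof. exact: ucl_le. Qed.

Lemma ucl_sum (T : Type) (s : seq T) (Q : pred T) (x : T -> forall i, L i) :
  \sum_(j <- s | Q j) (ucl mu (x j) : M) =
  ucl mu (fun i => \sum_(j <- s | Q j) x j i).
Proof.
elim: s => [|j s IHs].
  by rewrite big_nil; apply/uclP; apply: uaeW => i; rewrite big_nil.
rewrite big_cons {}IHs; case: ifP => Qj; rewrite ?ucl_addE; apply/uclP;
  by apply: uaeW => i; rewrite big_cons Qj.
Qed.

Lemma ucl_absm (x : forall i, L i) :
  absm (ucl mu x : M) = ucl mu (fun i => absm (x i)).
Proof.
have [x0|x0] := ordmod_le_total 0 (ucl mu x : M).
  rewrite ger0_absm //; apply/uclP; move: x0; rewrite ucl_leE.
  by apply: uae1 => i xi0; rewrite ger0_absm.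
rewrite ler0_absm // ucl_oppE; apply/uclP; move: x0; rewrite ucl_leE.
by apply: uae1 => i xi0; rewrite ler0_absm.
Qed.

Lemma model_uclP (x y : forall i, A i) :
  model_ucl mu x = model_ucl mu y <-> mu [set i | x i = y i].
Proof.
split=> [/ffunP xy|xy].
  have : mu [set i | forall b, x i b = y i b].
    by apply: uae_fin => b; apply/uclP; have := xy b; rewrite !ffunE.
  by apply: uae1 => i xyi; apply/ffunP.
by apply/ffunP => b; rewrite !ffunE; apply/uclP; apply: uae1 xy => i ->.
Qed.

Lemma model_urepr_ucl (x : forall i, A i) :
  mu [set i | model_urepr (model_ucl mu x) i = x i].
Proof. by apply/model_uclP; rewrite model_ureprK. Qed.

Lemma model_ucl_add (x y : forall i, A i) :
  model_ucl mu x + model_ucl mu y = model_ucl mu (fun i => x i + y i).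
Proof.
apply/ffunP => b; rewrite !ffunE ucl_addE; apply/uclP.
by apply: uaeW => i; rewrite ffunE.
Qed.

Lemma model_ucl_opp (x : forall i, A i) :
  - model_ucl mu x = model_ucl mu (fun i => - x i).
Proof.
apply/ffunP => b; rewrite !ffunE ucl_oppE; apply/uclP.
by apply: uaeW => i; rewrite ffunE.
Qed.

Lemma pairing_ucl (x : forall i, A i) a :
  pairing (model_ucl mu x) a = ucl mu (fun i => pairing (x i) a).
Proof.
rewrite /pairing -ucl_sum; apply: eq_bigr => b _; by rewrite ffunE ucl_scaleE.
Qed.

Lemma model_dist_ucl (x y : forall i, A i) :
  model_dist (model_ucl mu x) (model_ucl mu y) =
  ucl mu (fun i => model_dist (x i) (y i)).
Proof.
rewrite /model_dist -ucl_sum; apply: eq_bigr => a _.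
by rewrite model_ucl_opp model_ucl_add pairing_ucl ucl_absm.
Qed.

Lemma images_act_ucl (p : {ffun base Phi -> roots Phi}) (x : forall i, A i) :
  images_act p (model_ucl mu x) = model_ucl mu (fun i => images_act p (x i)).
Proof.
apply/ffunP => b; rewrite !ffunE; under eq_bigr do rewrite ffunE ucl_scaleE.
by rewrite ucl_sum; apply/uclP; apply: uaeW => i; rewrite ffunE.
Qed.

(* The spherical part ranges over a finite set that is the same for all [i],  *)
(* hence it is constant on a set of full measure.                              *)
Lemma affine_weyl_ucl (w : forall i, A i -> A i) :
  (forall i, affine_weyl (w i)) -> exists2 w' : ultraA -> ultraA, affine_weyl w' &
    forall x, w' (model_ucl mu x) = model_ucl mu (fun i => w i (x i)).
Proof.
move=> aw; have ex i : exists pt : {ffun base Phi -> roots Phi} * A i,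
    weyl_images pt.1 /\ w i = (fun x => images_act pt.1 x + pt.2).
  by have /(affine_weylE hF)[p [t pt]] := aw i; exists (p, t).
pose p i := (sval (cid (ex i))).1; pose t i := (sval (cid (ex i))).2.
have ptP i : weyl_images (p i) /\ w i = (fun x => images_act (p i) x + t i).
  exact: svalP (cid (ex i)).
(* Since [weyl_images] does not mention the value group, a single index [j] with [p j = q] certifies
   [q]. *)
have [q pq] := uae_pigeonhole mu p; have [j pjq] := uae_ex pq.
exists (fun x => images_act q x + model_ucl mu t).
  by apply/(affine_weylE hF); exists q, (model_ucl mu t); rewrite -pjq; have [] := ptP j.
move=> x; rewrite images_act_ucl model_ucl_add; apply/model_uclP.
by apply: uae1 pq => i <-; have [_ ->] := ptP i.
Qed.

(** The same linear part is used in every factor; only the translation is split into components. *)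
Lemma affine_weyl_urepr (w : ultraA -> ultraA) : affine_weyl w ->
  exists2 w' : forall i, A i -> A i, forall i, affine_weyl (w' i) &
    forall x, w (model_ucl mu x) = model_ucl mu (fun i => w' i (x i)).
Proof.
move=> /(affine_weylE hF)[p [t [pW ->]]].
exists (fun i x => images_act p x + model_urepr t i) => [i|x].
  by apply/(affine_weylE hF); exists p, (model_urepr t i).
by rewrite images_act_ucl -{1}[t]model_ureprK model_ucl_add.
Qed.

(** The counterpart of [internal] for points that are tuples of classes rather than classes of
    tuples. *)
Definition model_internal (S : forall i, set (A i)) : set ultraA :=
  [set x | mu [set i | S i (model_urepr x i)]].

Lemma model_internal_ucl S (x : forall i, A i) :
  model_internal S (model_ucl mu x) <-> mu [set i | S i (x i)].
Proof. by split; apply: uae2 (model_urepr_ucl x) => i ->. Qed.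

Lemma half_space_internal (k : forall i, L i) a :
  [set x : ultraA | (ucl mu k : M) <= pairing x a] =
  model_internal (fun i => [set x | k i <= pairing x a]).
Proof.
by apply/funext => x /=; rewrite -[in LHS](model_ureprK x) pairing_ucl ucl_leE.
Qed.

(** The chamber is cut out by finitely many inequalities, indexed by the finite type of roots, so
    [uae_fin] applies. *)
Lemma fundamental_chamber_internal :
  @fundamental_chamber R P F n Phi M =
  model_internal (fun i => @fundamental_chamber R P F n Phi (L i)).
Proof.
apply/seteqP; split=> x; rewrite -(model_ureprK x).
  move=> xF; apply/model_internal_ucl.
  have : mu [set i | forall a : roots Phi, positive_root Phi (\val a) ->
               0 <= pairing (model_urepr x i) (\val a)].
    apply: uae_fin => a; have [pa|npa] := pselect (positive_root Phi (\val a)).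
      have := xF _ pa; rewrite pairing_ucl ucl_leE; exact: uae1.
    by apply: uaeW.
  apply: uae1 => i xiF a pa; have [aR _] := pa.
  exact: (xiF [` aR]).
move=> /model_internal_ucl xF a pa; rewrite pairing_ucl ucl_leE.
by apply: uae1 xF => i /(_ a pa).
Qed.

Lemma convex_internal (C : forall i, set (A i)) :
  (forall i, convex (C i)) -> convex (model_internal C).
Proof.
move=> Cconv.
have ex i : exists eDk : (bool * {set roots Phi}) * (roots Phi -> L i), C i =
    [set x | eDk.1.1 /\ forall a, a \in eDk.1.2 -> eDk.2 a <= pairing x (\val a)].
  by have /(convexP hF)[e [D [k ->]]] := Cconv i; exists (e, D, k).
pose s i := (sval (cid (ex i))).1; pose k i := (sval (cid (ex i))).2.
have CE i : C i = [set x | (s i).1 /\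
    forall a, a \in (s i).2 -> k i a <= pairing x (\val a)].
  exact: svalP (cid (ex i)).
have [[e D] sE] := uae_pigeonhole mu s.
apply/(convexP hF); exists e, D, (fun a => ucl mu (fun i => k i a)).
apply/seteqP; split=> x; rewrite -(model_ureprK x).
  move=> /model_internal_ucl xC; split.
    by have [i [/=]] := uae_ex (umeasI sE xC); rewrite CE => -> [].
  move=> a aD; rewrite pairing_ucl ucl_leE; apply: uae2 sE xC => i sE.
  by rewrite CE sE => -[_]; apply.
move=> [eT xD]; apply/model_internal_ucl.
have : mu [set i | forall a, a \in D -> k i a <= pairing (model_urepr x i) (\val a)].
  apply: uae_fin => a; have [aD|aD] := boolP (a \in D); last by apply: uaeW.
  by have := xD a aD; rewrite pairing_ucl ucl_leE; apply: uae1.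
by apply: uae2 sE => i sE xiD; rewrite CE sE.
Qed.

Variable X : I -> Type.

(** A point of the right-hand side is reached by choosing preimages in almost all factors. *)
Lemma ultra_chart_image (f : forall i, A i -> X i) (S : forall i, set (A i)) :
  ultra_chart f @` model_internal S = internal (fun i => f i @` S i).
Proof.
apply/seteqP; split=> [_ [x xS <-]|y yS].
  by apply/internal_ucl; apply: uae1 xS => i xS; exists (model_urepr x i).
have [|x xP] := uae_choice (fun i => 0 : A i)
    (mu := mu) (Q := fun i x => S i x /\ f i x = urepr y i).
  by apply: uae1 yS => i [x Sx fx]; exists x.
exists (model_ucl mu x).
  by apply/model_internal_ucl; apply: uae1 xP => i [].
by rewrite ultra_chartE -[RHS]ureprK; apply/uclP; apply: uae1 xP => i [].
Qed.

Lemma ultra_chart_range (f : forall i, A i -> X i) :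
  range (ultra_chart (mu := mu) f) = internal (fun i => range (f i)).
Proof.
rewrite -ultra_chart_image; congr image.
by apply/seteqP; split=> x // _; apply: uaeW.
Qed.

Lemma ultra_chart_affine_weyl (f : forall i, A i -> X i) (w : ultraA -> ultraA)
    (w' : forall i, A i -> A i) :
  (forall x, w (model_ucl mu x) = model_ucl mu (fun i => w' i (x i))) ->
  ultra_chart f \o w = ultra_chart (fun i => f i \o w' i).
Proof.
move=> ww'; apply/funext => x; rewrite -(model_ureprK x) /= ww' !ultra_chartE //.
Qed.

End UltraModel.

(** * Normal forms of Weyl chambers and half-apartments *)

Section Charts.
Variables (R : realType) (P : pred R) (F : subFieldType P) (n : nat).
Variables (Phi : root_system R n) (hF : contains_coroot_evals Phi P).
Variables (L : orderedModType F) (X : Type) (charts : set (model Phi L -> X)).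
Hypothesis A1 : forall f w, charts f -> affine_weyl w -> charts (f \o w).

(** By (A1) the Weyl group element is absorbed into the chart, leaving images of one fixed set,
    which is internal in the ultraproduct. *)
Lemma bld_weyl_chamberP Y : bld_weyl_chamber charts Y <->
  exists2 f, charts f & Y = f @` @fundamental_chamber R P F n Phi L.
Proof.
split=> [[f [_ [cf [w aw ->] ->]]]|[f cf ->]].
  by exists (f \o w); [exact: A1|rewrite image_comp].
exists f, (@fundamental_chamber R P F n Phi L); split=> //.
by exists id; [exact: affine_weyl_id|rewrite image_id].
Qed.

Lemma bld_half_apartmentP Y : bld_half_apartment charts Y <->
  exists f a k, [/\ charts f, a \in Defs.roots Phi &
    Y = f @` [set x | k <= pairing x a]].
Proof.
split=> [[f [_ [cf /(half_apartmentP hF)[a [k [aR ->]]] ->]]]|[f [a [k [cf aR ->]]]]].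
  by exists f, a, k.
exists f, [set x | k <= pairing x a]; split=> //.
by apply/(half_apartmentP hF); exists a, k.
Qed.

End Charts.

(** * The building axioms for the ultraproduct *)

Section UltraBuilding.
Variables (R : realType) (P : pred R) (F : subFieldType P) (n : nat).
Variables (Phi : root_system R n) (hF : contains_coroot_evals Phi P).
Variables (I : Type) (mu : ultrafilter I).
Variables (L : I -> orderedModType F) (X : I -> Type).
Variable charts : forall i, set (model Phi (L i) -> X i).
Arguments charts : clear implicits.
Hypothesis hX : forall i, building (charts i).
Local Notation A i := (model Phi (L i)).
Local Notation ultraA := (model Phi (ultra_module mu L)).
Local Notation ultra_charts := (ultra_charts mu charts).

Lemma ultra_chart_inj f : ultra_charts f -> injective f.
Proof.
move=> [g cg ->] x y; rewrite -(model_ureprK x) -(model_ureprK y) !ultra_chartE.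
move=> /uclP gxy; apply/model_uclP; apply: uae1 gxy => i.
exact: (chart_inj (hX i) (cg i)).
Qed.

Lemma ultra_A1 f w : ultra_charts f -> affine_weyl w -> ultra_charts (f \o w).
Proof.
move=> [g cg ->] /(affine_weyl_urepr hF)[w' aw' ww'].
rewrite (ultra_chart_affine_weyl g ww'); exists (fun i => g i \o w' i) => // i.
exact: (building_A1 (hX i) (cg i) (aw' i)).
Qed.

Lemma ultra_A2 f g : ultra_charts f -> ultra_charts g ->
  convex (f @^-1` range g) /\
  exists2 w, affine_weyl w & forall x, range g (f x) -> f x = g (w x).
Proof.
move=> [f' cf ->] [g' cg ->]; have A2 i := building_A2 (hX i) (cf i) (cg i).
split.
  have -> : ultra_chart f' @^-1` range (ultra_chart g') =
      model_internal (mu := mu) (fun i => f' i @^-1` range (g' i)).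
    rewrite ultra_chart_range; apply/seteqP.
    split=> x; rewrite -(model_ureprK x) /preimage /= ultra_chartE.
      by move=> /internal_ucl ?; apply/model_internal_ucl.
    by move=> /model_internal_ucl ?; apply/internal_ucl.
  by apply: convex_internal => // i; have [] := A2 i.
have ex i : exists w, affine_weyl w /\
    forall x, range (g' i) (f' i x) -> f' i x = g' i (w x).
  by have [_ [w aw wE]] := A2 i; exists w.
pose w i := sval (cid (ex i)).
have wP i : affine_weyl (w i) /\
    forall x, range (g' i) (f' i x) -> f' i x = g' i (w i x).
  exact: svalP (cid (ex i)).
have [|w' aw' w'E] := affine_weyl_ucl hF mu (w := w); first by move=> i; have [] := wP i.
exists w' => // x; rewrite ultra_chart_range -(model_ureprK x) w'E !ultra_chartE.
move=> /internal_ucl gfx; apply/uclP; apply: uae1 gfx => i.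
by have [_] := wP i; apply.
Qed.

(** This is (A3), with charts and preimages chosen in all factors at once; the explicit preimages
    also serve to compute distances. *)
Lemma ultra_common_chart x y : exists f a b,
  [/\ ultra_charts f, f (model_ucl mu a) = x & f (model_ucl mu b) = y].
Proof.
have ex i : exists fab : (A i -> X i) * A i * A i,
    [/\ charts i fab.1.1, fab.1.1 fab.1.2 = urepr x i & fab.1.1 fab.2 = urepr y i].
  have [_ [[f cf ->] [a _ fa] [b _ fb]]] := building_A3 (hX i) (urepr x i) (urepr y i).
  by exists (f, a, b).
pose f i := (sval (cid (ex i))).1.1; pose a i := (sval (cid (ex i))).1.2.
pose b i := (sval (cid (ex i))).2.
have fab i : [/\ charts i (f i), f i (a i) = urepr x i & f i (b i) = urepr y i].
  exact: svalP (cid (ex i)).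
exists (ultra_chart f), a, b; rewrite !ultra_chartE.
split; [exists f => // i; by have [] := fab i|rewrite -[RHS]ureprK..];
  by apply/uclP; apply: uaeW => i; have [] := fab i.
Qed.

(** In a common chart both sides are model distances, where [model_dist_ucl] applies. *)
Lemma ultra_bld_distE (x y : forall i, X i) :
  bld_dist ultra_charts (ucl mu x) (ucl mu y) =
  ucl mu (fun i => bld_dist (charts i) (x i) (y i)).
Proof.
have [_ [a [b [[f cf ->] fa fb]]]] := ultra_common_chart (ucl mu x) (ucl mu y).
rewrite -fa -fb (bld_distE hF).
- rewrite model_dist_ucl; apply/uclP; move: fa fb; rewrite !ultra_chartE.
  move=> /uclP fa /uclP fb; apply: uae2 fa fb => i <- <-.
  rewrite (bld_distE hF) //; first exact: chart_inj (hX i).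
  by move=> ? ? cg ch; have [] := building_A2 (hX i) cg ch.
- exact: ultra_chart_inj.
- by move=> ? ? cg ch; have [] := ultra_A2 cg ch.
- by exists f.
Qed.

Lemma ultra_A4 S1 S2 :
  bld_weyl_chamber ultra_charts S1 -> bld_weyl_chamber ultra_charts S2 ->
  exists T1 T2 Y,
    [/\ bld_weyl_chamber ultra_charts T1 /\ T1 `<=` S1,
        bld_weyl_chamber ultra_charts T2 /\ T2 `<=` S2,
        apartment ultra_charts Y & T1 `|` T2 `<=` Y].
Proof.
move=> /(bld_weyl_chamberP ultra_A1)[_ [f cf ->] ->].
move=> /(bld_weyl_chamberP ultra_A1)[_ [g cg ->] ->].
pose C i := @fundamental_chamber R P F n Phi (L i).
have ex i : exists fgh : (A i -> X i) * (A i -> X i) * (A i -> X i),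
    [/\ charts i fgh.1.1 /\ fgh.1.1 @` C i `<=` f i @` C i,
        charts i fgh.1.2 /\ fgh.1.2 @` C i `<=` g i @` C i, charts i fgh.2 &
        fgh.1.1 @` C i `|` fgh.1.2 @` C i `<=` range fgh.2].
  have chamberP := bld_weyl_chamberP (building_A1 (hX i)).
  have [||T1 [T2 [_ [[cT1 T1S] [cT2 T2S] [h ch ->] TY]]]] :=
      building_A4 (hX i) (S1 := f i @` C i) (S2 := g i @` C i).
  - by apply/chamberP; exists (f i).
  - by apply/chamberP; exists (g i).
  have /chamberP[f' cf' f'E] := cT1; have /chamberP[g' cg' g'E] := cT2.
  by exists (f', g', h); split; rewrite /= -?f'E -?g'E.
pose f' i := (sval (cid (ex i))).1.1; pose g' i := (sval (cid (ex i))).1.2.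
pose h i := (sval (cid (ex i))).2.
have fghP i : [/\ charts i (f' i) /\ f' i @` C i `<=` f i @` C i,
        charts i (g' i) /\ g' i @` C i `<=` g i @` C i, charts i (h i) &
        f' i @` C i `|` g' i @` C i `<=` range (h i)].
  exact: svalP (cid (ex i)).
rewrite fundamental_chamber_internal !ultra_chart_image.
have sub (S T : forall i, set (X i)) : (forall i, S i `<=` T i) ->
    internal S `<=` internal (mu := mu) T.
  by move=> ST x; apply: uae1 => i; apply: ST.
exists (internal (fun i => f' i @` C i)), (internal (fun i => g' i @` C i)),
  (range (ultra_chart h)); split.
- split; last by apply: sub => i; have [[]] := fghP i.
  apply/(bld_weyl_chamberP ultra_A1); exists (ultra_chart f').
    by exists f' => // i; have [[]] := fghP i.
  by rewrite fundamental_chamber_internal ultra_chart_image.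
- split; last by apply: sub => i; have [_ []] := fghP i.
  apply/(bld_weyl_chamberP ultra_A1); exists (ultra_chart g').
    by exists g' => // i; have [_ []] := fghP i.
  by rewrite fundamental_chamber_internal ultra_chart_image.
- by exists (ultra_chart h) => //; exists h => // i; have [] := fghP i.
- rewrite ultra_chart_range => x [xT|xT]; apply: sub xT => i y yT;
    have [_ _ _ hT] := fghP i; apply: hT.
  + by left.
  + by right.
Qed.

Lemma ultra_A5 Y x : apartment ultra_charts Y -> Y x ->
  exists r : ultraproduct mu X -> ultraproduct mu X,
    [/\ forall y, Y (r y),
        forall y, Y y -> r y = y,
        forall y z, bld_dist ultra_charts (r y) (r z) <= bld_dist ultra_charts y z
      & r @^-1` [set x] = [set x]].
Proof.
(* The base point becomes the class of [f i (a i)], which lies in the apartment for every [i], so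
   (A5) applies in every factor. *)
move=> [_ [f cf ->] ->]; rewrite -(ureprK x) => -[a _].
rewrite -(model_ureprK a) ultra_chartE => <- {x}.
move: (model_urepr a) => {}a.
have ex i := building_A5 (hX i) (ex_intro2 _ _ _ (cf i) erefl) (imageT (f i) (a i)).
pose r i := sval (cid (ex i)).
have rP i : [/\ forall y, range (f i) (r i y),
    forall y, range (f i) y -> r i y = y,
    forall y z, bld_dist (charts i) (r i y) (r i z) <= bld_dist (charts i) y z
    & r i @^-1` [set f i (a i)] = [set f i (a i)]].
  exact: svalP (cid (ex i)).
exists (fun y => ucl mu (fun i => r i (urepr y i))); rewrite ultra_chart_range; split.
- by move=> y; apply/internal_ucl; apply: uaeW => i; have [] := rP i.
- move=> y yY; rewrite -[RHS]ureprK; apply/uclP; apply: uae1 yY => i.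
  by have [_ + _ _] := rP i; apply.
- move=> y z; rewrite -[y in X in _ <= X]ureprK -[z in X in _ <= X]ureprK.
  rewrite !ultra_bld_distE ucl_leE; apply: uaeW => i.
  by have [_ _ + _] := rP i; apply.
(* The fibre condition is restated pointwise, in which form it transfers in both directions. *)
- have rE i y : r i y = f i (a i) <-> y = f i (a i).
    have [_ _ _ rx] := rP i.
    by rewrite -[_ = _]/((r i @^-1` [set f i (a i)]) y) rx.
  apply/seteqP; split=> y; rewrite /preimage /=.
    move=> /uclP ry; rewrite -[y]ureprK; apply/uclP; apply: uae1 ry => i.
    by move/rE.
  move=> ->; apply/uclP; have := urepr_ucl mu (fun i => f i (a i)).
  by apply: uae1 => i yi; apply/rE.
Qed.

Lemma ultra_A6 Y1 Y2 Y3 :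
  apartment ultra_charts Y1 -> apartment ultra_charts Y2 ->
  apartment ultra_charts Y3 ->
  bld_half_apartment ultra_charts (Y1 `&` Y2) ->
  bld_half_apartment ultra_charts (Y1 `&` Y3) ->
  bld_half_apartment ultra_charts (Y2 `&` Y3) ->
  Y1 `&` Y2 `&` Y3 !=set0.
Proof.
move=> [_ [f1 c1 ->] ->] [_ [f2 c2 ->] ->] [_ [f3 c3 ->] ->].
pose x0 i := f1 i 0.
(* Once the bound [k] is split into components, the half-apartment is internal too, and equal
   internal sets have almost all components equal. *)
have half (S : forall i, set (X i)) : bld_half_apartment ultra_charts (internal S) ->
    mu [set i | bld_half_apartment (charts i) (S i)].
  move=> /(bld_half_apartmentP hF)[_ [b [k [[g cg ->] bR]]]].
  rewrite -[k]ureprK half_space_internal ultra_chart_image => /(internal_inj x0).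
  apply: uae1 => i ->; apply/(bld_half_apartmentP hF).
  by exists (g i), b, (urepr k i).
rewrite !ultra_chart_range !internalI => /half h12 /half h13 /half h23.
have [|x xP] := uae_choice x0 (mu := mu)
    (Q := fun i => range (f1 i) `&` range (f2 i) `&` range (f3 i)).
  apply: uae3 h12 h13 h23 => i h12 h13 h23.
  have apt (f : forall i, A i -> X i) : (forall i, charts i (f i)) ->
      apartment (charts i) (range (f i)) by exists (f i).
  exact: (building_A6 (hX i) (apt _ c1) (apt _ c2) (apt _ c3) h12 h13 h23).
by exists (ucl mu x); apply/internal_ucl.
Qed.

End UltraBuilding.

Theorem proposition6p2 (R : realType) (P : pred R) (F : subFieldType P) (n : nat)
    (Phi : root_system R n) (hF : contains_coroot_evals Phi P)
    (I : Type) (hI : infinite_set [set: I]) (mu : ultrafilter I)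
    (L : I -> orderedModType F) (X : I -> Type)
    (charts : forall i, set (model Phi (L i) -> X i))
    (hX : forall i, building (charts i)) :
  building (ultra_charts mu charts) /\
  exists d : ultraproduct mu X -> ultraproduct mu X -> ultra_module mu L,
    [/\ forall x y : forall i, X i,
          d (ucl mu x) (ucl mu y) =
          ucl mu (fun i => bld_dist (charts i) (x i) (y i)),
        is_metric d
      & forall x y, d x y = bld_dist (ultra_charts mu charts) x y].
Proof.
have bU : building (ultra_charts mu charts).
  split.
  - exact: ultra_chart_inj.
  - exact: ultra_A1.
  - exact: ultra_A2.
  - move=> x y; have [f [a [b [cf fa fb]]]] := ultra_common_chart hX x y.
    exists (range f); split; first by exists f.
      by exists (model_ucl mu a).
    by exists (model_ucl mu b).
  - exact: ultra_A4.
  - exact: ultra_A5.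
  - exact: ultra_A6.
split=> //; exists (bld_dist (ultra_charts mu charts)); split=> //.
- exact: ultra_bld_distE.
- exact: bld_dist_metric.
Qed.
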